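(* Any irreducible isotropic random walk with bounded range on any regular thick Fuchsian building has spectral radius strictly less than $1$.
   Context: A Coxeter system $(W,S)$ ($S$ finite) is $W=\langle S\mid s^2=1,\ (st)^{m_{st}}=1\ (s\neq t)\rangle$, $m_{st}=m_{ts}\in\{2,3,\dots\}\cup\{\infty\}$; $\ell$ is word length. It is Fuchsian if $S=\{s_1,\dots,s_n\}$, $n\ge3$, and there are integers $k_i\ge2$ with $\sum_{i=1}^n 1/k_i<n-2$ such that (indices cyclic mod $n$) $m_{s_is_{i+1}}=k_i$ and $m_{s_is_j}=\infty$ for $i\ne j$ not cyclically adjacent. A building of type $(W,S)$ is a nonempty set $\Delta$ with $\delta:\Delta\times\Delta\to W$ such that for $x,y\in\Delta$: (B1) $\delta(x,y)=1$ iff $x=y$; (B2) if $\delta(x,y)=w$ and $\delta(y,z)=s\in S$, then $\delta(x,z)\in\{w,ws\}$, and $\delta(x,z)=ws$ if $\ell(ws)=\ell(w)+1$; (B3) if $\delta(x,y)=w$ and $s\in S$ there is $z$ with $\delta(y,z)=s$ and $\delta(x,z)=ws$. It is regular if for every $s\in S$ the number $q_s=|\{y:\delta(x,y)=s\}|$ is finite and independent of $x\in\Delta$, thick if all $q_s\ge2$, and Fuchsian if $(W,S)$ is Fuchsian. A random walk (Markov chain) $(X_n)$ on $\Delta$ with transition probabilities $p(x,y)$ is isotropic if $p(x,y)$ depends only on $\delta(x,y)$; it has bounded range if there is $L$ with $p(x,y)=0$ whenever $\ell(\delta(x,y))>L$; it is irreducible if for all $x,y$ there is $n\ge1$ with $p^{(n)}(x,y)>0$.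 Its spectral radius is $\varrho(P)=\limsup_{n\to\infty}p^{(n)}(x,y)^{1/n}$ (independent of $x,y$ by irreducibility). *)

(* Defs.v *)
From HB Require Import structures.
From mathcomp Require Import all_boot all_order all_algebra.
From mathcomp Require Import all_classical all_reals all_analysis.

Set Implicit Arguments.
Unset Strict Implicit.
Unset Printing Implicit Defensive.

Import Order.TTheory GRing.Theory Num.Theory.

Local Open Scope classical_set_scope.

(* A letter (s, false) stands for s and (s, true) for
   s^-1; [pres_eq rel u v] says that u and v are equal in < S | rel >, i.e.
   equal in the free group on S modulo the normal closure of [rel]. *)
Inductive pres_eq (S : Type) (rel : seq (S * bool) -> Prop) :
    seq (S * bool) -> seq (S * bool) -> Prop :=
| pres_refl u : pres_eq rel u u
| pres_sym u v : pres_eq rel u v -> pres_eq rel v u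
| pres_trans u v w : pres_eq rel u v -> pres_eq rel v w -> pres_eq rel u w
| pres_cancel u v s b : pres_eq rel (u ++ [:: (s, b); (s, ~~ b)] ++ v) (u ++ v)
| pres_relator u v r : rel r -> pres_eq rel (u ++ r ++ v) (u ++ v).

Definition eval_word (S : Type) (W : groupType) (gen : S -> W)
    (u : seq (S * bool)) : W :=
  (\big[*%g/1]_(l <- u) if l.2 then (gen l.1)^-1 else gen l.1)%g.

Definition is_presentation (S : Type) (W : groupType) (gen : S -> W)
    (rel : seq (S * bool) -> Prop) : Prop :=
  (forall w : W, exists u, eval_word gen u = w) /\
  (forall u v, eval_word gen u = eval_word gen v <-> pres_eq rel u v).

(* m s t = None encodes m_{st} = oo; the diagonal of m is never used. *)
Definition is_coxeter_matrix (S : eqType) (m : S -> S -> option nat) : Prop :=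
  forall s t, s != t ->
    m s t = m t s /\ (forall k, m s t = Some k -> (2 <= k)%N).

Inductive coxeter_relator (S : eqType) (m : S -> S -> option nat) :
    seq (S * bool) -> Prop :=
| relator_square s : coxeter_relator m [:: (s, false); (s, false)]
| relator_braid s t k : s != t -> m s t = Some k ->
    coxeter_relator m (flatten (nseq k [:: (s, false); (t, false)])).

Definition is_coxeter_system (S : finType) (W : groupType) (gen : S -> W)
    (m : S -> S -> option nat) : Prop :=
  is_coxeter_matrix m /\ is_presentation gen (coxeter_relator m).

Definition has_word_of_size (S : Type) (W : groupType) (gen : S -> W) (w : W)
    (k : nat) : Prop :=
  exists u : seq S, size u = k /\ (\big[*%g/1]_(s <- u) gen s = w)%g.

(* The least size of a word in S representing w; the default value 0 is only
   taken when S does not generate W as a monoid, hence never in a Coxeter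
   system. *)
Definition word_length (S : Type) (W : groupType) (gen : S -> W) (w : W) : nat :=
  match pselect (exists k, `[< has_word_of_size gen w k >]) with
  | left h => ex_minn h
  | right _ => 0
  end.

Definition is_fuchsian (S : finType) (m : S -> S -> option nat) : Prop :=
  exists (n : nat) (s : 'I_n -> S) (k : 'I_n -> nat),
    [/\ (3 <= n)%N, bijective s & forall i, (2 <= k i)%N] /\
    [/\ (\sum_(i < n) ((k i)%:R)^-1 < n%:R - 2 :> rat)%R,
        (forall i, m (s i) (s (ordS i)) = Some (k i)) &
        (forall i j, i != j -> j != ordS i -> i != ordS j ->
           m (s i) (s j) = None)].

Record is_building (S : finType) (W : groupType) (gen : S -> W)
    (Delta : Type) (delta : Delta -> Delta -> W) : Prop := IsBuilding {
  building_nonempty : exists x : Delta, True ;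
  building_B1 : forall x y, delta x y = 1%g <-> x = y ;
  building_B2 : forall x y z w s, delta x y = w -> delta y z = gen s ->
    (delta x z = w \/ delta x z = (w * gen s)%g) /\
    (word_length gen (w * gen s)%g = (word_length gen w).+1 ->
       delta x z = (w * gen s)%g) ;
  building_B3 : forall x y w s, delta x y = w ->
    exists z, delta y z = gen s /\ delta x z = (w * gen s)%g }.

Definition is_regular (S : finType) (W : groupType) (gen : S -> W)
    (Delta : Type) (delta : Delta -> Delta -> W) (q : S -> nat) : Prop :=
  forall s x, ([set y | delta x y = gen s] #= `I_(q s))%card.

Definition is_thick (S : finType) (q : S -> nat) : Prop :=
  forall s, (2 <= q s)%N.

Section MarkovChain.
Variables (R : realType) (Delta : choiceType) (p : Delta -> Delta -> R).
Local Open Scope ring_scope.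
Local Open Scope ereal_scope.

Definition is_transition_matrix : Prop :=
  (forall x y, (0 <= p x y)%R) /\
  (forall x, \esum_(y in [set: Delta]) (p x y)%:E = 1).

Fixpoint transition_iter (n : nat) (x y : Delta) : \bar R :=
  match n with
  | 0%N => (x == y)%:R%:E
  | n'.+1 => \esum_(z in [set: Delta]) ((p x z)%:E * transition_iter n' z y)
  end.

Definition is_irreducible : Prop :=
  forall x y, exists n, (1 <= n)%N /\ 0 < transition_iter n x y.

Definition spectral_radius (x y : Delta) : \bar R :=
  limn_esup (fun n => transition_iter n x y `^ (n%:R^-1)%R).

Definition is_isotropic (W : Type) (delta : Delta -> Delta -> W) : Prop :=
  forall x y x' y', delta x y = delta x' y' -> p x y = p x' y'.

Definition has_bounded_range (S : Type) (W : groupType) (gen : S -> W)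
    (delta : Delta -> Delta -> W) : Prop :=
  exists L : nat, forall x y,
    (L < word_length gen (delta x y))%N -> p x y = 0%R.

End MarkovChain.

(* Main.v *)
Require Import Defs.
From mathcomp Require Import all_boot all_order all_algebra.
From mathcomp Require Import all_classical all_reals all_analysis.
From mathcomp Require Import ring lra zify.

(** Fix a base chamber o and write l(w) for the length of w in W. If s increases
    the length of w = delta(o, x), all s-neighbours of x are at Weyl distance w
    s from o; otherwise one of them is, and the q_s - 1 others are at distance
    w. Since q_s >= 2, a random s-step changes l by +1 at an ascent and by
    -1/q_s >= -1/2 on average at a descent: a building branches.

    Suppose that some function phi on W with bounded increments has, for the
    walk that picks s in a fixed set J and then moves to a random s-neighbour,
    drift bounded below by a positive constant (below, the drift is summed and
    not averaged over s in J). Then the radial function exp(-a phi(delta(o, x)))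
    is multiplied by some c < 1 at most by the kernel Q of this walk
    ([adjacency_contraction]), and as Q is symmetric, Schur's test bounds its
    norm on l^2 by c ([schur_test]).

    Such a phi exists for Fuchsian groups ([fuchsian_potential]). If two
    generators s, t have m(s,t) infinite, take J = {s, t} and phi a multiple of
    l: no w has both descents, so the drift of l is at least 1 - 1/2. In the
    remaining case of a triangle group take J = S; no w has three descents, so l
    has drift at least 1 - 1/2 - 1/2 = 0, and within a bounded number of steps
    there is an element with at most one descent, where the drift is at least
    3/2; a bounded correction of l spreads this gain ([drift_correction]). The
    restrictions on descents come from the geometric representation: w sends the
    simple root of a descent to a negative root (Tits' theorem,
    [chamber_point_ascent] and [chamber_point_descent]), whereas w x - x is a
    nonnegative combination of simple roots when x pairs nonpositively with
    every simple root. So the support of such an x >= 0 never consists of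
    descents of w ([exists_ascent_in]). For the triangle group the angle sum is
    less than pi, which provides x ([triangle_ascent]).

    An isotropic random walk P is compared with Q as follows. Thickness and the
    homogeneity of the building ([delta_transfer]) give N and e > 0 with P^N >=
    e Q entrywise ([common_crossing_time]), and P^N is doubly stochastic since
    spheres have the same size seen from either end ([sphere_count]). Hence P^N
    is e Q plus a kernel of norm at most 1 - e, the norm of P^N is less than 1,
    and the transition probabilities decay exponentially. *)

Set Implicit Arguments.
Unset Strict Implicit.
Unset Printing Implicit Defensive.

Import Order.TTheory GRing.Theory Num.Theory.

(** * Words, lengths and alternating products in a Coxeter group *)

Section CoxeterGroups.
Variables (S : finType) (W : groupType) (gen : S -> W).
Variable m : S -> S -> option nat.
Hypothesis coxW : is_coxeter_system gen m.

Local Notation len := (word_length gen).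
Local Open Scope group_scope.

Definition word_prod (u : seq S) : W := \big[*%g/1]_(s <- u) gen s.

Lemma word_prod_rcons u s : word_prod (rcons u s) = word_prod u * gen s.
Proof. by rewrite /word_prod -cats1 big_cat /= big_seq1. Qed.

Lemma gen_sqr s : gen s * gen s = 1.
Proof.
have [_ [_ /(_ [:: (s, false); (s, false)] [::])[_]]] := coxW.
rewrite /eval_word !big_cons !big_nil /= mulg1; apply.
exact: (@pres_relator _ _ [::] [::] _ (relator_square m s)).
Qed.

Lemma gen_inv s : (gen s)^-1 = gen s.
Proof. by rewrite (mulg1_eq (gen_sqr s)). Qed.

Lemma mul_genK w s : w * gen s * gen s = w.
Proof. by rewrite -mulgA gen_sqr mulg1. Qed.

Lemma eval_wordE u : eval_word gen u = word_prod (map fst u).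
Proof.
rewrite /eval_word /word_prod big_map; apply: eq_bigr => -[s b] _ /=.
by rewrite gen_inv if_same.
Qed.

Lemma word_prod_surj w : exists u, word_prod u = w.
Proof.
have [_ [/(_ w)[u <-] _]] := coxW.
by exists (map fst u); rewrite eval_wordE.
Qed.

Lemma gen_braid s t k : s != t -> m s t = Some k -> (gen s * gen t) ^+ k = 1.
Proof.
move=> st mst.
have [_ [_ /(_ (flatten (nseq k [:: (s, false); (t, false)])) [::])[_]]] := coxW.
rewrite {2}/eval_word big_nil => <-; last first.
  have := @pres_relator _ _ [::] [::] _ (relator_braid st mst).
  by rewrite cats0.
rewrite /eval_word; elim: k {mst} => [|k IH] /=; first by rewrite big_nil.
by rewrite !big_cons /= -IH expgS mulgA.
Qed.

(** The universal property of the presentation, for right actions: a family of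
    commands indexed by [S] that satisfies the Coxeter relations acts through
    [W]. It is used with values in [bool] for the parity of the length, and with
    functions on [S] for the contragredient geometric representation. *)
Lemma coxeter_action (A : Type) (act : A -> S -> A) :
  (forall a s, act (act a s) s = a) ->
  (forall s t k, s != t -> m s t = Some k ->
     forall a, foldl act a (flatten (nseq k [:: s; t])) = a) ->
  forall u v, word_prod u = word_prod v ->
  forall a, foldl act a u = foldl act a v.
Proof.
move=> act_sq act_braid u v uv.
suff pres u' v' : pres_eq (coxeter_relator m) u' v' ->
    forall a, foldl act a (map fst u') = foldl act a (map fst v').
  have [_ [_ /(_ (map (pair^~ false) u) (map (pair^~ false) v))[+ _]]] := coxW.
  rewrite !eval_wordE -!map_comp !map_id => /(_ uv)/pres {}pres a.
  by have := pres a; rewrite -!map_comp !map_id.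
elim=> {u v uv u' v'} [//|u v _ IH a|u v w _ IH1 _ IH2 a|u v s b a|u v r rel_r a].
- by rewrite IH.
- by rewrite IH1.
- by rewrite !map_cat /= !foldl_cat /= act_sq.
- rewrite !map_cat !foldl_cat; congr foldl.
  case: rel_r => [s|s t k st mst] /=; first exact: act_sq.
  by rewrite map_flatten map_nseq act_braid.
Qed.

Lemma word_lengthP w : has_word_of_size gen w (len w) /\
  forall u, word_prod u = w -> (len w <= size u)%N.
Proof.
rewrite /word_length; case: pselect => [ex|[]]; last first.
  by have [u uw] := word_prod_surj w; exists (size u); apply/asboolP; exists u.
case: ex_minnP => n /asboolP wn n_min; split=> // u uw.
by apply: n_min; apply/asboolP; exists u.
Qed.

Lemma reduced_word w : exists2 u, size u = len w & word_prod u = w.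
Proof. by have [[u [? ?]] _] := word_lengthP w; exists u. Qed.

Lemma word_length_prod u : (len (word_prod u) <= size u)%N.
Proof. exact: (word_lengthP _).2. Qed.

Lemma odd_word_length u : odd (len (word_prod u)) = odd (size u).
Proof.
have [v <- vu] := reduced_word (word_prod u).
pose flip (b : bool) (s : S) := ~~ b.
have foldl_flip (x : seq S) b : foldl flip b x = odd (size x) (+) b.
  elim: x b => //= s x IH b; rewrite IH /flip; by case: odd; case: b.
have := @coxeter_action _ flip (fun a s => negbK a) _ v u vu false.
rewrite !foldl_flip !addbF; apply=> s t k _ _ b; rewrite foldl_flip.
by rewrite size_flatten /shape map_nseq sumn_nseq mul2n odd_double.
Qed.

Lemma odd_word_length_mul w s : odd (len (w * gen s)) = ~~ odd (len w).
Proof.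
have [u uw] := word_prod_surj w.
by rewrite -uw -word_prod_rcons !odd_word_length size_rcons.
Qed.

Lemma word_length_mul_le w s : (len (w * gen s) <= (len w).+1)%N.
Proof.
have [u <- uw] := reduced_word w.
by rewrite -{1}uw -word_prod_rcons -(size_rcons u s) word_length_prod.
Qed.

Definition ascent w s := len (w * gen s) == (len w).+1.

Lemma ascentP w s : ascent w s -> len (w * gen s) = (len w).+1.
Proof. by move/eqP. Qed.

(** By parity, multiplication by a generator never preserves the length. *)
Lemma descentP w s : ~~ ascent w s -> len w = (len (w * gen s)).+1.
Proof.
rewrite /ascent => nasc; have le1 := word_length_mul_le w s.
have := word_length_mul_le (w * gen s) s; rewrite mul_genK => le2.
have := odd_word_length_mul w s; move: nasc le1 le2; lia.
Qed.

Lemma ascent_mul w s : ascent (w * gen s) s = ~~ ascent w s.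
Proof.
apply/idP/idP => [/ascentP|/descentP].
  by rewrite mul_genK /ascent => ->; lia.
by rewrite /ascent mul_genK => ->.
Qed.

Lemma mul_gen_neq w s : w * gen s <> w.
Proof. by move=> ws; have := odd_word_length_mul w s; rewrite ws; case: odd. Qed.

Lemma exists_descent w : w != 1 -> exists s, ~~ ascent w s.
Proof.
have [u + uw] := reduced_word w; case/lastP: u uw => [uw _|u s uw size_u _].
  by rewrite -uw /word_prod big_nil eqxx.
exists s; rewrite -(mul_genK w s) ascent_mul; apply/negPn.
rewrite /ascent mul_genK -size_u size_rcons eqSS -uw word_prod_rcons mul_genK.
have := word_length_mul_le (word_prod u) s; rewrite -word_prod_rcons uw -size_u.
by rewrite size_rcons ltnS => le1; rewrite eqn_leq le1 word_length_prod.
Qed.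

Lemma reduced_ind (P : W -> Prop) :
  P 1 -> (forall w s, ascent w s -> P w -> P (w * gen s)) -> forall w, P w.
Proof.
move=> P1 PS w; have [n] := ubnP (len w); elim: n w => // n IH w lt_wn.
have [-> //|/exists_descent[s ws]] := eqVneq w 1.
rewrite -(mul_genK w s); apply: PS; first by rewrite ascent_mul.
by apply: IH; rewrite -ltnS -(descentP ws).
Qed.

Fixpoint alt (s t : S) (n : nat) : W :=
  if n is n'.+1 then alt t s n' * gen t else 1.

Lemma altSl s t n : alt s t n.+1 = gen (if odd n then s else t) * alt s t n.
Proof.
elim: n s t => [|n IH] s t /=; first by rewrite mul1g mulg1.
by rewrite -/(alt t s n.+1) IH -mulgA; case: odd.
Qed.

Lemma alt_add s t i j :
  alt s t (i + j) = (if odd j then alt t s i else alt s t i) * alt s t j.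
Proof.
elim: j s t => [|j IH] s t; first by rewrite addn0 mulg1.
by rewrite addnS /= IH mulgA; case: odd.
Qed.

Lemma alt_inv_mul s t n : (alt t s n)^-1 * alt s t n = (gen s * gen t) ^+ n.
Proof.
elim: n s t => [|n IH] s t /=; first by rewrite invg1 mulg1.
have -> : (gen s * gen t) ^+ n.+1 = gen s * (gen t * gen s) ^+ n * gen t.
  elim: n {IH} => [|n IH]; first by rewrite expg0 mulg1.
  by rewrite expgSr IH expgSr !mulgA.
by rewrite invgM gen_inv -!mulgA (mulgA (alt s t n)^-1) IH.
Qed.

Lemma alt_braid s t k : s != t -> m s t = Some k -> alt s t k = alt t s k.
Proof.
move=> st mst; have := alt_inv_mul s t k; rewrite (gen_braid st mst).
by move/mulg1_eq; rewrite invgK.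
Qed.

Lemma word_length_alt v s t n : (len (v * alt s t n) <= len v + n)%N.
Proof.
elim: n s t => [|n IH] s t /=; first by rewrite mulg1 addn0.
by rewrite mulgA (leq_trans (word_length_mul_le _ _))// addnS ltnS.
Qed.

(** The minimal representative [v] of the coset of [w] by the dihedral group
    generated by [s] and [t] is reached by removing [t], [s], [t], ... on the
    right as long as the length drops: when it would rise, the letter removed
    last is an ascent as well. *)
Lemma dihedral_decomposition w s t : ~~ ascent w t ->
  exists j v, [/\ w = v * alt s t j.+1, len w = (len v + j.+1)%N,
                  ascent v s & ascent v t].
Proof.
move=> wt.
suff descend n v j : (len v <= n)%N -> w = v * alt s t j.+1 ->
    len w = (len v + j.+1)%N -> exists j v, [/\ w = v * alt s t j.+1,
      len w = (len v + j.+1)%N, ascent v s & ascent v t].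
  apply: (descend (len (w * gen t)) (w * gen t) 0) => //=.
    by rewrite mul1g mul_genK.
  by rewrite (descentP wt) addn1.
elim: n v j => [|n IH] v j le_vn wE lenw.
(* [v] times the first letter of the alternating word is longer than [v], for
   otherwise [w] would be shorter. *)
all: have vr' : ascent v (if odd j then s else t).
1,3: apply/negPn/negP => /descentP lenv;
  have := word_length_alt (v * gen (if odd j then s else t)) s t j;
  rewrite -[X in len X](_ : w = _) ?lenw ?lenv; [lia|];
  rewrite wE altSl mulgA ?mul_genK; by [].
all: have [vr|/descentP lenv] := boolP (ascent v (if odd j then t else s)).
1,3: by exists j, v; case: (odd j) vr vr' => ? ?.
- by move: le_vn; rewrite lenv.
- apply: (IH (v * gen (if odd j then t else s)) j.+1).
  + by rewrite -ltnS -lenv.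
  + by rewrite altSl /= if_neg mulgA mul_genK.
  + by rewrite lenw lenv addSnnS.
Qed.

(** Once an alternating word is longer than the braid relation, the relation
    makes two equal letters adjacent. *)
Lemma alt_reduced_le v s t j k : s != t -> m s t = Some k ->
  len (v * alt s t j) = (len v + j)%N -> (j <= k)%N.
Proof.
move=> st mst lenw; rewrite leqNgt; apply/negP => lt_kj.
have [_ /(_ _ mst)] := coxW.1 _ _ st.
case: k mst lt_kj => // k mst lt_kj _.
have altE : alt s t k.+2 = alt t s k.
  by have /= braid := alt_braid st mst; rewrite /= -braid mul_genK.
have jE : j = (j - k.+2 + k.+2)%N by rewrite subnK.
move: lenw; rewrite {1}jE alt_add altE mulgA.
set x := v * _ => lenw; have := word_length_alt x t s k.
have : (len x <= len v + (j - k.+2))%N.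
  by rewrite /x; case: ifP => _; apply: word_length_alt.
by rewrite lenw; lia.
Qed.

Lemma alt_reduced_descent v s t k : s != t -> m s t = Some k ->
  len (v * alt s t k) = (len v + k)%N -> ~~ ascent (v * alt s t k) s.
Proof.
move=> st mst lenw; have [_ /(_ _ mst)] := coxW.1 _ _ st.
case: k mst lenw => // k mst lenw _.
apply/negP => /ascentP; rewrite lenw (alt_braid st mst) /= mulgA mul_genK.
by have := word_length_alt v s t k => /[swap] ->; lia.
Qed.

End CoxeterGroups.

(** * The contragredient geometric representation *)

Section GeometricRepresentation.
Variables (R : realType) (S : finType) (W : groupType) (gen : S -> W).
Variable m : S -> S -> option nat.
Hypothesis coxW : is_coxeter_system gen m.
Local Notation ascent := (ascent gen).
Local Notation alt := (alt gen).
Local Open Scope ring_scope.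

(** The Gram matrix of the simple roots. *)
Definition cox_form (s t : S) : R :=
  if s == t then 1 else if m s t is Some k then - cos (pi / k%:R) else -1.

(** The simple reflections in coordinates dual to the simple roots. A linear
    form a on the root space is stored as its values on the simple roots, so
    that positivity of roots becomes positivity of values. *)
Definition reflection (a : S -> R) (r : S) : S -> R :=
  fun s => a s - 2 * cox_form s r * a r.

Lemma cox_form_diag s : cox_form s s = 1.
Proof. by rewrite /cox_form eqxx. Qed.

Lemma cox_form_sym s t : cox_form s t = cox_form t s.
Proof.
rewrite /cox_form (eq_sym t); case: eqVneq => // st.
by have [-> _] := coxW.1 _ _ st.
Qed.

Lemma angle_bounds k : (2 <= k)%N -> 0 < (pi : R) / k%:R <= pi / 2.
Proof.
move=> k2; have k0 : (0 : R) < k%:R by rewrite ltr0n; lia.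
rewrite divr_gt0 ?pi_gt0//= ler_pM2l ?pi_gt0// lef_pV2 ?posrE// ?ltr0n//.
by rewrite ler_nat.
Qed.

Lemma cox_form_le0 s t : s != t -> cox_form s t <= 0.
Proof.
move=> st; have [_ le2] := coxW.1 _ _ st.
rewrite /cox_form (negbTE st); case mst: (m s t) => [k|]; last lra.
have /andP[a0 a1] := angle_bounds (le2 _ mst).
rewrite oppr_le0 cos_ge0_pihalf// a1 andbT (le_trans _ (ltW a0))// oppr_le0.
by rewrite divr_ge0 ?pi_ge0.
Qed.

Lemma reflectionK a s : reflection (reflection a s) s = a.
Proof. by apply/funext => r; rewrite /reflection cox_form_diag; ring. Qed.

(** [cheb c n] is the Chebyshev value U_{n-1}(c), which at c = cos x is sin (n
    x) / sin x. *)
Fixpoint cheb_pair (c : R) (n : nat) : R * R :=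
  if n is n'.+1 then
    let: (x, y) := cheb_pair c n' in (y, 2 * c * y - x)
  else (0, 1).
Definition cheb c n := (cheb_pair c n).1.

Lemma chebSS c n : cheb c n.+2 = 2 * c * cheb c n.+1 - cheb c n.
Proof. by rewrite /cheb /=; case: (cheb_pair c n). Qed.

Lemma cheb_sin x n : cheb (cos x) n * sin x = sin (n%:R * x).
Proof.
suff: cheb (cos x) n * sin x = sin (n%:R * x) /\
      cheb (cos x) n.+1 * sin x = sin (n.+1%:R * x) by case.
elim: n => [|n [IH0 IH1]]; first by rewrite /cheb /= !mul0r sin0 !mul1r.
split=> //; rewrite chebSS mulrBl IH0 -(mulrA _ (cheb _ _)) IH1.
have -> : n.+2%:R * x = n.+1%:R * x + x by rewrite -!natr1; ring.
have -> : n%:R * x = n.+1%:R * x - x by rewrite -natr1; ring.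
by rewrite sinB sinD; ring.
Qed.

Lemma cheb1 n : cheb 1 n = n%:R.
Proof.
suff: cheb 1 n = n%:R /\ cheb 1 n.+1 = n.+1%:R by case.
elim: n => [|n [IH0 IH1]]; first by rewrite /cheb.
by split=> //; rewrite chebSS IH0 IH1 -!natr1; ring.
Qed.

Lemma cheb_form_ge0 s t n : s != t ->
  (forall k, m s t = Some k -> (n <= k)%N) -> 0 <= cheb (- cox_form s t) n.
Proof.
move=> st le_n; have [_ le2] := coxW.1 _ _ st.
rewrite /cox_form (negbTE st); case mst: (m s t) => [k|]; last first.
  by rewrite opprK cheb1.
have k2 := le2 _ mst; have /andP[a0 a1] := angle_bounds k2.
have k0 : (0 : R) < k%:R by rewrite ltr0n; lia.
have sin_gt0 : 0 < sin ((pi : R) / k%:R).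
  by rewrite sin_gt0_pi// a0 (le_lt_trans a1)// gtr_pMr ?pi_gt0// invf_lt1 ?ltr1n.
rewrite opprK -(pmulr_lge0 _ sin_gt0) cheb_sin.
apply: sin_ge0_pi; apply/andP; split; first by rewrite mulr_ge0// ltW.
by rewrite mulrCA ler_piMr ?pi_ge0// ler_pdivrMr// mul1r ler_nat le_n.
Qed.

(** When the form takes the value - cos x at the two roots, the product of the
    reflections turns the phase of the two coordinates by 2 x. *)
Lemma rotation_iter a s t n (c := - cox_form s t) (x : R) : c = cos x ->
  let a' := foldl reflection a (flatten (nseq n [:: s; t])) in
  a' s * sin x = a s * sin (n.*2.+1%:R * x) + a t * sin (n.*2%:R * x) /\
  a' t * sin x = - (a s * sin (n.*2%:R * x) + a t * sin (n.*2%:R * x - x)).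
Proof.
move=> cE; elim: n a => [|n IH] a /=.
  by rewrite !mul0r mul1r sub0r sinN sin0; split; ring.
have bE : cox_form s t = - cos x by rewrite -cE /c opprK.
have [-> ->] := IH (reflection (reflection a s) t).
rewrite /reflection !cox_form_diag (cox_form_sym t s) bE.
set y := n.*2%:R * x.
have -> : n.*2.+1%:R * x = y + x by rewrite -natr1 mulrDl mul1r.
have -> : n.*2.+3%:R * x = y + x + x + x.
  by rewrite -!natr1 !mulrDl mul1r.
have -> : n.*2.+2%:R * x = y + x + x by rewrite -!natr1 !mulrDl mul1r.
rewrite addrK.
(* Both sides are polynomials in the sines and cosines of x and y, which agree
   modulo the relation cs. *)
have cs : sin x ^+ 2 = 1 - cos x ^+ 2 by rewrite sin2cos2.
rewrite sinB !(sinD, cosD).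
split.
  transitivity ((a s * (cos x ^+ 2 * 4 - 1) + a t * 2 * cos x) *
      (sin y * cos x + cos y * sin x) - (2 * cos x * a s + a t) * sin y).
    by ring.
  transitivity (a s * (sin y * (cos x ^+ 3 - 3 * cos x * sin x ^+ 2) +
      cos y * sin x * (3 * cos x ^+ 2 - sin x ^+ 2)) +
      a t * (sin y * (cos x ^+ 2 - sin x ^+ 2) + 2 * cos y * cos x * sin x)).
    by rewrite cs; ring.
  by ring.
transitivity (- ((a s * (cos x ^+ 2 * 4 - 1) + a t * 2 * cos x) * sin y -
    (2 * cos x * a s + a t) * (sin y * cos x - cos y * sin x))).
  by ring.
transitivity (- (a s * (sin y * (cos x ^+ 2 - sin x ^+ 2) +
    2 * cos y * cos x * sin x) + a t * (sin y * cos x + cos y * sin x))).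
  by rewrite cs; ring.
by ring.
Qed.

(** The product of the reflections in [s] and [t] is a rotation by twice the
    angle pi / k in the plane of the coordinates [s] and [t]; every other
    coordinate becomes invariant after adding a combination of these two, as the
    plane is nondegenerate. *)
Lemma reflection_braid s t k : s != t -> m s t = Some k ->
  forall a, foldl reflection a (flatten (nseq k [:: s; t])) = a.
Proof.
move=> st mst a; have [_ /(_ _ mst) k2] := coxW.1 _ _ st.
have /andP[a0 a1] := angle_bounds k2.
have k0 : (0 : R) < k%:R by rewrite ltr0n; lia.
set x := (pi : R) / k%:R in a0 a1 *.
have sx : sin x != 0.
  rewrite gt_eqF// sin_gt0_pi// a0 (le_lt_trans a1)//.
  by rewrite gtr_pMr ?pi_gt0// invf_lt1 ?ltr1n.
have bE : cox_form s t = - cos x by rewrite /cox_form (negbTE st) mst.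
have [] := @rotation_iter a s t k x; first by rewrite bE opprK.
have kx : k.*2%:R * x = pi *+ 2.
  by rewrite -muln2 natrM /x -[RHS]mulr_natr; field; rewrite gt_eqF.
rewrite -natr1 mulrDl mul1r kx sin2pi (addrC _ x) sinD2pi sinB sin2pi cos2pi.
move=> as' at'.
set a' := foldl _ _ _ in as' at' *.
have {}as' : a' s = a s.
  by apply: (mulIf sx); rewrite as'; ring.
have {}at' : a' t = a t.
  by apply: (mulIf sx); rewrite at'; ring.
apply/funext => r.
(* The vector alpha_r + u alpha_s + v alpha_t is orthogonal to alpha_s and
   alpha_t. *)
pose u := - (cox_form r s + cos x * cox_form r t) / sin x ^+ 2.
pose v := - (cox_form r t + cos x * cox_form r s) / sin x ^+ 2.
have inv1 (e : S -> R) : let f := reflection (reflection e s) t in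
    f r + u * f s + v * f t = e r + u * e s + v * e t.
  rewrite /reflection /= !cox_form_diag (cox_form_sym t s) bE /u /v.
  have cs : sin x ^+ 2 = 1 - cos x ^+ 2 by rewrite sin2cos2.
  have cs0 : 1 - cos x ^+ 2 != 0 by rewrite -cs expf_neq0.
  by rewrite cs; field.
have inv n (e : S -> R) : let f := foldl reflection e (flatten (nseq n [:: s; t])) in
    f r + u * f s + v * f t = e r + u * e s + v * e t.
  by elim: n e => [//|n IH] e /=; rewrite IH inv1.
have := inv k a; rewrite /= -/a' as' at'; lra.
Qed.

(** The composite of [w] and the linear form with value 1 at every simple root,
    which lies in the interior of the fundamental chamber; the value at [s] is
    the sum of the coordinates of the root w alpha_s. *)
Definition chamber_point (w : W) : S -> R :=
  foldl reflection (fun=> 1) (sval (cid (word_prod_surj coxW w))).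

Lemma chamber_point1 : chamber_point 1%g = fun=> 1.
Proof.
rewrite /chamber_point; case: cid => u /= u1.
rewrite (coxeter_action coxW reflectionK reflection_braid (v := [::]))//.
by rewrite u1 /word_prod big_nil.
Qed.

Lemma chamber_point_mul w s :
  chamber_point (w * gen s)%g = reflection (chamber_point w) s.
Proof.
rewrite /chamber_point; case: cid => u /= uw; case: cid => v /= vw.
rewrite (coxeter_action coxW reflectionK reflection_braid (v := rcons v s)).
  by rewrite foldl_rcons.
by rewrite word_prod_rcons vw.
Qed.

Lemma chamber_point_alt v s t n (c := - cox_form s t) :
  let: (x, y) := if odd n then (t, s) else (s, t) in
  chamber_point (v * alt s t n)%g s =
  cheb c n.+1 * chamber_point v x + cheb c n * chamber_point v y.
Proof.
have alt_reflection s' t' n' : chamber_point (v * alt s' t' n'.+1)%g =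
    reflection (chamber_point (v * alt t' s' n')%g) t'.
  by rewrite /= mulgA chamber_point_mul.
suff IH i s' t' : cox_form s' t' = - c ->
    (let: (x, y) := if odd i then (t', s') else (s', t') in
    chamber_point (v * alt s' t' i)%g s' =
      cheb c i.+1 * chamber_point v x + cheb c i * chamber_point v y) /\
    (let: (x, y) := if odd i.+1 then (t', s') else (s', t') in
    chamber_point (v * alt s' t' i.+1)%g s' =
      cheb c i.+2 * chamber_point v x + cheb c i.+1 * chamber_point v y).
  by have [] := IH n s t (esym (opprK _)).
elim: i s' t' => [|i IH] s' t' st'; have ts' : cox_form t' s' = - c.
- by rewrite cox_form_sym.
- rewrite alt_reflection /reflection st' /= mulg1 chebSS.
  by split; rewrite /cheb /=; ring.
- by rewrite cox_form_sym.
have [_ H] := IH _ _ st'; split=> //.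
have [_] := IH _ _ ts'.
have -> : chamber_point (v * alt s' t' i.+2)%g s' =
   2 * c * chamber_point (v * alt t' s' i.+1)%g t' -
   chamber_point (v * alt s' t' i)%g s'.
  rewrite alt_reflection {1}/reflection st' alt_reflection {1}/reflection.
  by rewrite cox_form_diag; ring.
have [+ _] := IH _ _ st'.
rewrite [cheb c i.+3]chebSS [in cheb c i.+2]chebSS /= negbK.
by case: (odd i) => /= -> -> ; rewrite ?chebSS; ring.
Qed.

(** Tits' theorem, that w sends alpha_s to a positive root at an ascent. Write
    [w] as [v] times an alternating product in [s] and [t], with [v] minimal in
    its coset; the coordinates of [v] at [s] and [t] are nonnegative by
    induction, and those of [w] are combinations with Chebyshev coefficients,
    which are nonnegative because the product has fewer than [m s t] factors. *)
Lemma chamber_point_ascent w s : ascent w s -> 0 <= chamber_point w s.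
Proof.
have [n] := ubnP (word_length gen w); elim: n w s => // n IH w s lt_wn ws.
have [->|/(exists_descent coxW)[t wt]] := eqVneq w 1%g.
  by rewrite chamber_point1.
have st : s != t by apply: contraNneq wt => <-.
have [j [v [wE lenw vs vt]]] := dihedral_decomposition coxW s wt.
have v_ge0 r : ascent v r -> 0 <= chamber_point v r.
  by apply: IH; rewrite lenw in lt_wn; lia.
have lt_j k : m s t = Some k -> (j.+2 <= k)%N.
  move=> mst; have := alt_reduced_le (v := v) coxW st mst (j := j.+1).
  rewrite -wE => /(_ lenw); rewrite leq_eqVlt => /predU1P[kE|//].
  have := alt_reduced_descent (v := v) (k := k) coxW st mst.
  by rewrite -kE -wE => /(_ lenw)/negP.
have := chamber_point_alt v s t j.+1; rewrite -wE.
have u0 := cheb_form_ge0 st (n := j.+1) (fun k e => ltnW (lt_j k e)).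
have u1 := cheb_form_ge0 st lt_j.
by case: odd => ->; rewrite addr_ge0// mulr_ge0// v_ge0.
Qed.

Lemma chamber_point_descent w s : ~~ ascent w s -> chamber_point w s <= 0.
Proof.
move=> ws; have := @chamber_point_ascent (w * gen s)%g s.
rewrite (ascent_mul coxW) chamber_point_mul /reflection cox_form_diag => /(_ ws).
lra.
Qed.

(** As x pairs nonpositively with the simple roots, the pairing of x with the
    chamber point does not decrease along ascents, and hence stays positive; it
    would be nonpositive if all of the support of x consisted of descents. *)
Lemma exists_ascent_in (J : {set S}) (x : S -> R) :
  (forall s, 0 <= x s) -> (exists s, 0 < x s) -> (forall s, s \notin J -> x s = 0) ->
  (forall r, \sum_s x s * cox_form s r <= 0) ->
  forall w, exists2 s, s \in J & ascent w s.
Proof.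
move=> x_ge0 [s0 xs0] xJ xB w.
have [/exists_inP[s sJ ws]|/exists_inPn desc] := boolP [exists s in J, ascent w s].
  by exists s.
have pair_gt0 : 0 < \sum_s x s * chamber_point w s.
  elim/(reduced_ind coxW): w {desc} => [|w r wr IH].
    rewrite chamber_point1; apply: (@lt_le_trans _ _ (x s0)) => //.
    by rewrite (bigD1 s0)//= mulr1 lerDl sumr_ge0// => s _; rewrite mulr1.
  rewrite chamber_point_mul (lt_le_trans IH)// -subr_ge0 -sumrB.
  rewrite (eq_bigr (fun s => - (2 * chamber_point w r) * (x s * cox_form s r))).
    rewrite -mulr_sumr mulNr oppr_ge0 mulr_ge0_le0// mulr_ge0//.
    exact: chamber_point_ascent.
  by move=> s _; rewrite /reflection; ring.
suff : \sum_s x s * chamber_point w s <= 0 by rewrite leNgt pair_gt0.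
apply: sumr_le0 => s _; have [sJ|/xJ->] := boolP (s \in J); last by rewrite mul0r.
by rewrite mulr_ge0_le0// chamber_point_descent// desc.
Qed.

End GeometricRepresentation.

(** * Descents in Fuchsian Coxeter groups *)

Section Fuchsian.
Variables (R : realType) (S : finType) (W : groupType) (gen : S -> W).
Variable m : S -> S -> option nat.
Hypothesis coxW : is_coxeter_system gen m.
Local Notation ascent := (ascent gen).
Local Notation cform := (cox_form R m).
Local Open Scope ring_scope.

(** Equality holds for a0 = b0 and a2 = b2, and smaller angles have larger
    cosines. *)
Lemma triangle_sine (a0 a2 b0 b1 b2 : R) : 0 <= a0 <= b0 -> 0 <= a2 <= b2 ->
  0 < b0 -> 0 < b1 -> 0 < b2 -> b0 + b1 + b2 = pi ->
  sin b1 <= cos a0 * sin b2 + cos a2 * sin b0.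
Proof.
move=> /andP[a0_ge0 ab0] /andP[a2_ge0 ab2] b0_gt0 b1_gt0 b2_gt0 bpi.
have -> : b1 = pi - (b0 + b2) by rewrite -bpi; ring.
have sin_ge0 b : 0 < b -> b < pi -> 0 <= sin b.
  by move=> ? ?; rewrite ltW// sin_gt0_pi//; apply/andP.
have le_cos a b : 0 <= a -> a <= b -> b < pi -> cos b <= cos a.
  move=> a_ge0 ab bp; have pi0 := @pi_gt0 R.
  by rewrite leNgt ltr_cos ?in_itv/= -?leNgt//; apply/andP; split; lra.
have -> : sin (pi - (b0 + b2)) = sin (b0 + b2).
  by rewrite sinB sinpi cospi; ring.
rewrite sinD addrC lerD// ?[sin b0 * _]mulrC ler_wpM2r ?sin_ge0 ?le_cos//;
  have pi0 := @pi_gt0 R; lra.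
Qed.

(** The sum of the two simple roots is isotropic and pairs nonpositively with
    every simple root. *)
Lemma pair_ascent s t : s != t -> m s t = None ->
  forall w, exists2 r, r \in [set s; t] & ascent w r.
Proof.
move=> st mst; have stN1 : cform s t = -1.
  by rewrite /cox_form (negbTE st) mst.
apply: (exists_ascent_in coxW (x := fun r => (r \in [set s; t])%:R : R)).
- by move=> r; rewrite ler0n.
- by exists s; rewrite !inE eqxx.
- by move=> r /negbTE ->.
move=> r; rewrite (bigD1 s)//= (bigD1 t)/=; last by rewrite eq_sym.
rewrite !inE !eqxx orbT !mul1r big1 ?addr0; last first.
  by move=> u /andP[us ut]; rewrite !inE (negbTE us) (negbTE ut) mul0r.
have [->|rs] := eqVneq r s.
  by rewrite cox_form_diag (cox_form_sym R coxW) stN1 subrr.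
have [->|rt] := eqVneq r t; first by rewrite cox_form_diag stN1 addNr.
have := @cox_form_le0 R _ _ _ _ coxW s r; rewrite eq_sym => /(_ rs).
have := @cox_form_le0 R _ _ _ _ coxW t r; rewrite eq_sym => /(_ rt).
lra.
Qed.

(** Enlarge the angles pi / k_i of the hyperbolic triangle until they are those
    of a Euclidean triangle; the sines of the latter are the coordinates of a
    vector to which [exists_ascent_in] applies. *)
Lemma triangle_ascent (s : 'I_3 -> S) (k : 'I_3 -> nat) : bijective s ->
  (forall i, (2 <= k i)%N) -> \sum_(i < 3) ((k i)%:R)^-1 < 1 :> rat ->
  (forall i, m (s i) (s (ordS i)) = Some (k i)) ->
  forall w, exists r, ascent w r.
Proof.
move=> s_bij k2 sum_k ms w.
have [g sK gK] := s_bij; have s_inj := can_inj sK.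
pose i0 : 'I_3 := @Ordinal 3 0 isT; pose i1 : 'I_3 := @Ordinal 3 1 isT.
pose i2 : 'I_3 := @Ordinal 3 2 isT.
pose a i : R := pi / (k i)%:R.
have a_gt0 i : 0 < a i by have /andP[] := @angle_bounds R _ (k2 i).
have sum_a : a i0 + a i1 + a i2 < pi.
  move: sum_k; rewrite -(ltr_rat R) rmorph1 rmorph_sum.
  rewrite !big_ord_recl big_ord0 addr0 /= !fmorphV !rmorph_nat.
  have -> : lift ord0 ord0 = i1 by apply: val_inj.
  have -> : lift ord0 (lift ord0 ord0) = i2 :> 'I_3 by apply: val_inj.
  have -> : ord0 = i0 by apply: val_inj.
  by rewrite /a -!mulrDr -addrA gtr_pMr ?pi_gt0.
pose b0 := pi - a i1 - a i2.
(* The angle at i0 absorbs the defect; each coordinate is the sine of the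
   opposite angle. *)
pose y (i : 'I_3) : R :=
  if i == i0 then sin (a i1) else if i == i1 then sin (a i2) else sin b0.
have le_pi c : 0 < c -> c < pi -> 0 < sin c.
  by move=> ? ?; rewrite sin_gt0_pi//; apply/andP.
have [[a0 a1] a2] := (a_gt0 i0, a_gt0 i1, a_gt0 i2).
have y_gt0 i : 0 < y i.
  by rewrite /y; do 2?case: ifP => _; apply: le_pi; rewrite ?/b0; lra.
suff: exists2 r, r \in [set: S] & ascent w r by case=> r _ wr; exists r.
apply: (exists_ascent_in coxW (x := y \o g)).
- by move=> r; rewrite ltW /=.
- by exists (s i0); rewrite /= sK.
- by move=> r; rewrite inE.
- move=> r; rewrite -(gK r); set i := g r.
  rewrite (reindex s) /=; last by exists g => ? _.
  rewrite !big_ord_recl big_ord0 addr0.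
  have -> : lift ord0 ord0 = i1 by apply: val_inj.
  have -> : lift ord0 (lift ord0 ord0) = i2 :> 'I_3 by apply: val_inj.
  have -> : ord0 = i0 by apply: val_inj.
  rewrite !sK.
  have form i' j : j = ordS i' -> i' != j -> cform (s i') (s j) = - cos (a i').
    by move=> -> ne; rewrite /cox_form (inj_eq s_inj) (negbTE ne) ms.
  have f01 : cform (s i0) (s i1) = - cos (a i0) by apply: form => //; apply: val_inj.
  have f12 : cform (s i1) (s i2) = - cos (a i1) by apply: form => //; apply: val_inj.
  have f20 : cform (s i2) (s i0) = - cos (a i2) by apply: form => //; apply: val_inj.
  have f10 : cform (s i1) (s i0) = - cos (a i0) by rewrite (cox_form_sym R coxW) f01.
  have f21 : cform (s i2) (s i1) = - cos (a i1) by rewrite (cox_form_sym R coxW) f12.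
  have f02 : cform (s i0) (s i2) = - cos (a i2) by rewrite (cox_form_sym R coxW) f20.
  rewrite /y /=.
  have t0 := @triangle_sine (a i0) (a i2) b0 (a i1) (a i2).
  have t1 := @triangle_sine (a i1) (a i0) (a i1) (a i2) b0.
  have t2 := @triangle_sine (a i2) (a i1) (a i2) b0 (a i1).
  have {}t0 : sin (a i1) <= cos (a i0) * sin (a i2) + cos (a i2) * sin b0.
    by apply: t0; rewrite /b0; lra.
  have {}t1 : sin (a i2) <= cos (a i1) * sin b0 + cos (a i0) * sin (a i1).
    by apply: t1; rewrite /b0; lra.
  have {}t2 : sin b0 <= cos (a i2) * sin (a i1) + cos (a i1) * sin (a i2).
    by apply: t2; rewrite /b0; lra.
  have [->|->|->] : [\/ i = i0, i = i1 | i = i2].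
    by case: i => -[|[|[|//]]] ?; [apply: Or31|apply: Or32|apply: Or33]; apply: val_inj.
  + by rewrite cox_form_diag f10 f20; lra.
  + by rewrite cox_form_diag f01 f21; lra.
  + by rewrite cox_form_diag f02 f12; lra.
Qed.

(** With at least four generators two of them generate an infinite dihedral
    group; with three, all proper parabolic subgroups are finite. *)
Lemma fuchsian_ascents : is_fuchsian m ->
  exists J : {set S}, (forall w, exists2 s, s \in J & ascent w s) /\
    (#|J| = 2 \/ (#|J| = 3 /\ exists K, forall s t, s != t ->
       exists2 k, m s t = Some k & (k <= K)%N)).
Proof.
move=> [n [s [k [[n3 s_bij k2] [sum_k ms mN]]]]].
have s_inj := bij_inj s_bij.
move: n3; rewrite leq_eqVlt => /predU1P[n3|n4].
- subst n; exists [set: S]; split.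
    move=> w; have [|r wr] := @triangle_ascent s k s_bij k2 _ ms w; last by exists r.
    by move: sum_k; congr (_ < _); rewrite -[3%:R](natrD _ 1 2) addrK.
  right; have [g sK gK] := s_bij.
  split; first by rewrite cardsT -(bij_eq_card s_bij) card_ord.
  exists (\max_(i < 3) k i) => r t rt.
  have [i ri] : exists i, r = s i by exists (g r); rewrite gK.
  have [j tj] : exists j, t = s j by exists (g t); rewrite gK.
  have ij : i != j by apply: contraNneq rt => ij; rewrite ri tj ij.
  have le_k i' : (k i' <= \max_(i < 3) k i)%N by apply: leq_bigmax.
  have [jS|jS] := eqVneq j (ordS i); first by exists (k i); rewrite // ri tj jS ms.
  have [iS|iS] := eqVneq i (ordS j).
    exists (k j); last exact: le_k.
    by have [-> _] := coxW.1 _ _ rt; rewrite ri tj iS ms.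
  move: ij iS jS; rewrite -!val_eqE /=.
  by have := ltn_ord i; have := ltn_ord j; lia.
- pose i0 : 'I_n := Ordinal (ltnW (ltnW (ltnW n4))).
  pose i2 : 'I_n := Ordinal (ltnW n4).
  have mN2 : m (s i0) (s i2) = None.
    by apply: mN; rewrite -val_eqE /= ?modn_small; lia.
  exists [set s i0; s i2]; split; last by left; rewrite cards2 (inj_eq s_inj).
  by apply: pair_ascent; rewrite ?(inj_eq s_inj).
Qed.

End Fuchsian.

(** * A function of positive drift on the Coxeter group *)

Section Potential.
Variables (R : realType) (S : finType) (W : groupType) (gen : S -> W).
Variable m : S -> S -> option nat.
Hypothesis coxW : is_coxeter_system gen m.
Variable q : S -> nat.
Hypothesis thickq : is_thick q.
Local Notation ascent := (ascent gen).
Local Notation len := (word_length gen).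
Local Open Scope ring_scope.

(** The proportion of the [s]-neighbours of a chamber at Weyl distance [w] from
    the base chamber whose Weyl distance is [w * gen s]; the others stay at
    distance [w]. *)
Definition move_prob (w : W) (s : S) : R :=
  if ascent w s then 1 else (q s)%:R^-1.

Definition drift (J : {set S}) (f : W -> R) (w : W) : R :=
  \sum_(s in J) move_prob w s * (f (w * gen s)%g - f w).

Local Notation rlen := (fun w : W => (len w)%:R : R).

Lemma move_prob_gt0 w s : 0 < move_prob w s.
Proof.
by rewrite /move_prob; case: ifP => // _; rewrite invr_gt0 ltr0n ltnW// thickq.
Qed.

Lemma move_prob_le1 w s : move_prob w s <= 1.
Proof.
rewrite /move_prob; case: ifP => // _; rewrite invf_le1 ?ler1n ?ltr0n; exact: ltnW.
Qed.

Lemma descent_move_prob w s : ~~ ascent w s -> move_prob w s <= 2^-1.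
Proof.
move=> /negbTE nws; rewrite /move_prob nws lef_pV2 ?posrE ?ltr0n//; last exact: ltnW.
by rewrite ler_nat.
Qed.

Lemma length_drift (J : {set S}) w :
  #|J|%:R - 3 / 2 * #|[set s in J | ~~ ascent w s]|%:R <= drift J rlen w.
Proof.
have -> : #|J|%:R - 3 / 2 * #|[set s in J | ~~ ascent w s]|%:R =
    \sum_(s in J) (1 - 3 / 2 * (~~ ascent w s)%:R) :> R.
  rewrite big_split /= sumr_const sumrN -mulr_sumr -natr_sum.
  congr (_ - _ * _%:R); rewrite -sum1_card big_mkcond [RHS]big_mkcond /=.
  by apply: eq_bigr => s _; rewrite inE; case: (s \in J) => //=; case: ascent.
apply: ler_sum => s sJ; have [ws|nws] := boolP (ascent w s) => /=.
  by rewrite mulr0 subr0 /move_prob ws mul1r (ascentP ws) -natr1 addrAC subrr add0r.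
have := descent_move_prob nws.
rewrite (descentP coxW nws) -[(len _).+1%:R]natr1 opprD addrA subrr sub0r mulrN1; lra.
Qed.

Lemma alt_inv_word s t n : exists u : seq S,
  [/\ all (mem [set s; t]) u, size u = n & word_prod gen u = (alt gen s t n)^-1%g].
Proof.
elim: n s t => [|n IH] s t /=.
  by exists [::]; rewrite /word_prod big_nil invg1.
have [u [uJ uS uP]] := IH t s; exists (t :: u); split => /=.
- rewrite !inE eqxx orbT /= (eq_all (a2 := mem [set t; s]))// => r.
  by rewrite !inE orbC.
- by rewrite uS.
- by rewrite invgM (gen_inv coxW) -uP /word_prod big_cons.
Qed.

(** An ascent contributes 1 to the drift of the length and a descent at least
    -1/2. If [J] has two elements, at most one is a descent. For a triangle
    group the drift may vanish at [w] with two descents [s] and [t], but it is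
    positive at the minimal element of the coset of [w] by the group generated
    by [s] and [t], which is near [w] since this group is finite. *)
Lemma fuchsian_length_drift : is_fuchsian m ->
  exists (J : {set S}) (K : nat), (0 < #|J|)%N /\ forall w,
    0 <= drift J rlen w /\
    exists u, [/\ all (mem J) u, (size u <= K)%N &
                  2^-1 <= drift J rlen (w * word_prod gen u)%g].
Proof.
move=> /(fuchsian_ascents R coxW)[J [J_asc Jcases]].
pose d w := #|[set s in J | ~~ ascent w s]|.
have lt_d w : (d w < #|J|)%N.
  have [s sJ ws] := J_asc w; apply: proper_card; apply/properP; split.
    by apply/fintype.subsetP => r; rewrite inE => /andP[].
  by exists s; rewrite // inE ws andbF.
exists J; case: Jcases => [J2|[J3 [K mK]]].
  exists 0; rewrite J2; split=> // w.
  have d_ge w' : 2^-1 <= drift J rlen w'.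
    have := length_drift J w'; have := lt_d w'; rewrite -/(d w') J2.
    by rewrite ltnS -(ler_nat R); lra.
  split; first by have := d_ge w; lra.
  by exists [::]; split.
exists K; rewrite J3; split=> // w.
have d_le1 w' : (d w' <= 1)%N -> 2^-1 <= drift J rlen w'.
  by have := length_drift J w'; rewrite -/(d w') J3 -(ler_nat R); lra.
split.
  have := length_drift J w; have := lt_d w; rewrite -/(d w) J3.
  by rewrite ltnS -(ler_nat R); lra.
have [/d_le1 le1|] := leqP (d w) 1; first by
  exists [::]; rewrite /word_prod big_nil mulg1.
case/card_gt1P => s [t [+ + st]]; rewrite !inE => /andP[sJ ws] /andP[tJ wt].
have [j [v [wE lenw vs vt]]] := dihedral_decomposition coxW s wt.
have [k mst le_k] := mK s t st.
have [u [uJ uS uP]] := alt_inv_word s t j.+1; exists u; split.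
- apply: sub_all uJ => r /=; rewrite !inE.
  by case/orP => /eqP ->.
- rewrite uS (leq_trans _ le_k)//.
  by apply: (alt_reduced_le (v := v) coxW st mst); rewrite -wE.
- rewrite uP {1}wE mulgK; apply: d_le1.
  have sub : [set r in J | ~~ ascent v r] \subset J :\: [set s; t].
    apply/fintype.subsetP => r; rewrite !inE => /andP[-> vr]; rewrite andbT.
    by apply: contraNN vr => /orP[]/eqP ->.
  rewrite (leq_trans (subset_leq_card sub))// cardsD (finset.setIidPr _).
    by rewrite J3 cards2 st.
  by rewrite finset.subUset !finset.sub1set sJ tJ.
Qed.

(** A bounded correction of a multiple of the length turns its nonnegative drift
    into one that is bounded below: it is M^(K - tau), with tau the number of
    steps needed to reach a place where the length has drift at least 1/2. As M
    is large, one step closer to such a place outweighs all other steps. *)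
Lemma drift_correction (J : {set S}) (K : nat) : (0 < #|J|)%N ->
  (forall w, 0 <= drift J rlen w /\ exists u, [/\ all (mem J) u, (size u <= K)%N &
                  2^-1 <= drift J rlen (w * word_prod gen u)%g]) ->
  exists (f : W -> R) (C : R), 1 <= C /\ forall w,
    1 <= drift J f w /\ forall s, `|f (w * gen s)%g - f w| <= C.
Proof.
move=> J_gt0 H.
pose reach w j := exists u, [/\ all (mem J) u, size u = j &
                  2^-1 <= drift J rlen (w * word_prod gen u)%g].
have ex_reach w : exists j, `[< reach w j >].
  by have [_ [u [? _ ?]]] := H w; exists (size u); apply/asboolP; exists u.
pose tau w := ex_minn (ex_reach w).
have tauP w : reach w (tau w) /\ forall j, reach w j -> (tau w <= j)%N.
  rewrite /tau; case: ex_minnP => j /asboolP rj j_min; split=> // i ri.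
  by apply: j_min; apply/asboolP.
have tau_le w : (tau w <= K)%N.
  have [_ [u [? uK ?]]] := H w; apply: leq_trans uK; apply: (tauP w).2.
  by exists u.
have tau0 w : tau w = 0 -> 2^-1 <= drift J rlen w.
  have [[u [_ uS du]] _] := tauP w => tw0.
  by move: uS du; rewrite tw0 => /size0nil ->; rewrite /word_prod big_nil mulg1.
have tauS w : tau w != 0 -> exists2 s, s \in J & (tau (w * gen s)%g < tau w)%N.
  have [[[|s u] [uJ uS du]] _] := tauP w; first by rewrite -uS.
  move: uJ => /= /andP[sJ uJ] _; exists s => //; rewrite -uS.
  rewrite ltnS; apply: (tauP _).2; exists u; split=> //.
  by move: du; rewrite /word_prod big_cons mulgA.
pose theta : R := (\sum_s q s).+1%:R^-1.
have theta_gt0 : 0 < theta by rewrite invr_gt0 ltr0n.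
have theta_le w s : theta <= move_prob w s.
  rewrite /move_prob; case: ifP => _; first by rewrite invf_le1 ?ler1n ?ltr0n.
  rewrite lef_pV2 ?posrE ?ltr0n ?(ltnW (thickq s))// ler_nat.
  by rewrite (bigD1 s)//= -addnS leq_addr.
pose n : R := #|J|%:R; have n_ge1 : 1 <= n by rewrite ler1n.
pose M : R := 1 + (n + 1) / theta.
have M_ge1 : 1 <= M by rewrite lerDl divr_ge0 ?ltW//; lra.
pose psi w := M ^+ (K - tau w).
have psi_gt0 w : 0 < psi w by rewrite exprn_gt0//; lra.
have psi_le w : psi w <= M ^+ K by rewrite ler_weXn2l// leq_subr.
pose A := 2 * (n * M ^+ K + 1).
have MK_ge1 : 1 <= M ^+ K by rewrite exprn_ege1.
have nMK : 1 <= n * M ^+ K by rewrite mulr_ege1.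
exists (fun w => A * (len w)%:R + psi w), (A + M ^+ K).
split; first by rewrite /A; lra.
move=> w; split; last first.
  move=> s; have := psi_gt0 w; have := psi_gt0 (w * gen s)%g.
  have := psi_le w; have := psi_le (w * gen s)%g.
  have [ws|nws] := boolP (ascent w s).
    rewrite (ascentP ws) -[(len _).+1%:R]natr1 ler_norml /A => *.
    by apply/andP; split; lra.
  rewrite (descentP coxW nws) -[(len _).+1%:R]natr1 ler_norml /A => *.
  by apply/andP; split; lra.
have -> : drift J (fun w => A * (len w)%:R + psi w) w =
    A * drift J rlen w + drift J psi w.
  rewrite /drift mulr_sumr -big_split; apply: eq_bigr => s _ /=; ring.
have lower s : - psi w <= move_prob w s * (psi (w * gen s)%g - psi w).
  have := move_prob_gt0 w s; have := move_prob_le1 w s.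
  have := psi_gt0 w; have := psi_gt0 (w * gen s)%g; nra.
have [tw0|tw] := eqVneq (tau w) 0.
  have drift_psi : - (n * M ^+ K) <= drift J psi w.
    rewrite /n mulr_natl -mulNrn -sumr_const; apply: ler_sum => s sJ.
    by apply: le_trans (lower s); rewrite lerN2 psi_le.
  have := tau0 _ tw0; rewrite /A; nra.
have [s sJ tws] := tauS _ tw.
have A_ge0 : 0 <= A * drift J rlen w by rewrite mulr_ge0 ?(H w).1// /A; lra.
have psi_ws : M * psi w <= psi (w * gen s)%g.
  rewrite /psi -exprS ler_weXn2l//; have := tau_le w; lia.
have psi_ge1 : 1 <= psi w by rewrite exprn_ege1.
have : psi w * (theta * (M - 1) - n) <= drift J psi w.
  rewrite /drift (bigD1 s)//= mulrBr lerD//.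
    have psi_step : (M - 1) * psi w <= psi (w * gen s)%g - psi w by lra.
    apply: (@le_trans _ _ (theta * (psi (w * gen s)%g - psi w))).
      by rewrite mulrC -mulrA ler_wpM2l// ltW.
    by rewrite ler_wpM2r// (le_trans _ psi_step)// mulr_ge0 ?subr_ge0// ltW.
  apply: le_trans (ler_sum _ (fun i _ => lower i)).
  rewrite sumr_const mulNrn lerN2 -mulr_natr ler_wpM2l ?(ltW (psi_gt0 _))//.
  by rewrite ler_nat; apply: subset_leq_card; apply/fintype.subsetP => i /andP[].
have -> : theta * (M - 1) - n = 1 by rewrite /M; field; rewrite gt_eqF.
lra.
Qed.

Lemma fuchsian_potential : is_fuchsian m ->
  exists (J : {set S}) (f : W -> R) (C : R), [/\ (0 < #|J|)%N, 1 <= C &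
    forall w, 1 <= drift J f w /\ forall s, `|f (w * gen s)%g - f w| <= C].
Proof.
move=> /fuchsian_length_drift[J [K [J_gt0 /(drift_correction J_gt0)[f [C [C1 fP]]]]]].
by exists J, f, C.
Qed.

End Potential.

(** * Sums of nonnegative families *)

Section NonnegativeSums.
Variable R : realType.
Local Open Scope classical_set_scope.
Local Open Scope ring_scope.
Local Open Scope ereal_scope.

Lemma esumZl (T : choiceType) (c : R) (f : T -> \bar R) : (0 <= c)%R ->
  (forall x, 0 <= f x) ->
  \esum_(x in [set: T]) (c%:E * f x) = c%:E * \esum_(x in [set: T]) f x.
Proof.
move=> c_ge0 f_ge0.
have le_sum (d : R) (g : T -> \bar R) : (0 <= d)%R -> (forall x, 0 <= g x) ->
    \esum_(x in [set: T]) (d%:E * g x) <= d%:E * \esum_(x in [set: T]) g x.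
  move=> d0 g0; apply: ge_ereal_sup => _ [A [finA AT] <-].
  rewrite -ge0_mule_fsumr// lee_wpmul2l ?lee_fin//.
  by apply: ereal_sup_ubound; exists A.
apply/eqP; rewrite eq_le le_sum//=.
move: c_ge0; rewrite [(0 <= c)%R]le_eqVlt => /predU1P[<-|c0].
  by rewrite mul0e esum_ge0// => x _; rewrite mul0e.
rewrite -[leRHS]mul1e -(@divff _ c) ?gt_eqF// EFinM -muleA.
rewrite lee_wpmul2l ?lee_fin ?(ltW c0)//.
rewrite -[X in X <= _](@eq_esum _ _ _ (fun x => (c^-1)%:E * (c%:E * f x))).
  by apply: le_sum => [|x]; rewrite ?mule_ge0 ?lee_fin ?invr_ge0 ?(ltW c0).
by move=> x _; rewrite muleA -EFinM mulVf ?gt_eqF// mul1e.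
Qed.

Lemma esum_exchange (T1 T2 : choiceType) (f : T1 -> T2 -> \bar R) :
  (forall x y, 0 <= f x y) ->
  \esum_(x in [set: T1]) \esum_(y in [set: T2]) f x y =
  \esum_(y in [set: T2]) \esum_(x in [set: T1]) f x y.
Proof.
move=> f_ge0; rewrite !esum_esum//.
rewrite (@reindex_esum _ _ _ ([set: T2] `*`` (fun=> [set: T1]))
  ([set: T1] `*`` (fun=> [set: T2])) (fun k => (k.2, k.1)))//.
split=> //; first by move=> [x y] [x' y'] _ _ [-> ->].
by move=> [x y] _; exists (y, x).
Qed.

Lemma esum_single (T : choiceType) (z : T) (f : T -> \bar R) :
  0 <= f z -> (forall x, x <> z -> f x = 0) -> \esum_(x in [set: T]) f x = f z.
Proof.
move=> fz f0; rewrite -(esum_set1 fz) [RHS]esum_mkcond; apply: eq_esum => x _.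
by case: ifPn => //; rewrite notin_setE => /= /f0.
Qed.

Lemma esum_pos_exists (T : choiceType) (f : T -> \bar R) : (forall x, 0 <= f x) ->
  0 < \esum_(x in [set: T]) f x -> exists x, 0 < f x.
Proof.
move=> f_ge0 sum_gt0; apply: contrapT => nex; move: sum_gt0.
rewrite esum1 ?ltxx// => x _; apply/eqP; rewrite eq_le f_ge0 andbT leNgt.
by apply/negP => fx; apply: nex; exists x.
Qed.

Lemma esum_ge_term (T : choiceType) (z : T) (f : T -> \bar R) : (forall x, 0 <= f x) ->
  f z <= \esum_(x in [set: T]) f x.
Proof.
move=> f_ge0; rewrite (esumID [set z])// setTI esum_set1// leeDl// esum_ge0//.
Qed.

End NonnegativeSums.

(** * Schur test and decay of transition probabilities *)

Section FormBounds.
Variables (R : realType) (T : choiceType).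
Implicit Types (k : T -> T -> R) (g h : T -> R) (c : R).
Local Open Scope classical_set_scope.
Local Open Scope ring_scope.

Definition sqnorm g : \bar R := (\esum_(x in [set: T]) (g x ^+ 2)%:E)%E.

(** Scaling f and g in opposite directions shows that, for k >= 0, this says
    that k has operator norm at most c on l^2(T). As only nonnegative functions
    occur, all sums make sense in the extended reals. *)
Definition form_bound k c := forall f g,
  (forall x, 0 <= f x) -> (forall x, 0 <= g x) ->
  (\esum_(x in [set: T]) \esum_(y in [set: T]) (k x y * f x * g y)%:E <=
   (c / 2)%:E * (sqnorm f + sqnorm g))%E.

Lemma sqnorm_ge0 g : (0 <= sqnorm g)%E.
Proof. by apply: esum_ge0 => x _; rewrite lee_fin sqr_ge0. Qed.

(** Schur's test: bound f x * g y by the arithmetic mean of f x ^ 2 * h y / h x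
    and g y ^ 2 * h x / h y, and sum. *)
Lemma schur_test k h c : (forall x y, 0 <= k x y) -> (forall x, 0 < h x) ->
  (forall x, (\esum_(y in [set: T]) (k x y * h y)%:E <= (c * h x)%:E)%E) ->
  (forall y, (\esum_(x in [set: T]) (k x y * h x)%:E <= (c * h y)%:E)%E) ->
  form_bound k c.
Proof.
move=> k_ge0 h_gt0 rows cols f g f_ge0 g_ge0.
pose A (e : T -> R) (x : T) : R := e x ^+ 2 / (2 * h x).
have A_ge0 e x : 0 <= A e x by rewrite divr_ge0 ?sqr_ge0// mulr_ge0// ltW.
have half (kk : T -> T -> R) (e : T -> R) : (forall x y, 0 <= kk x y) ->
    (forall x, (\esum_(y in [set: T]) (kk x y * h y)%:E <= (c * h x)%:E)%E) ->
    (\esum_(x in [set: T]) \esum_(y in [set: T]) (A e x * (kk x y * h y))%:E <=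
     (c / 2)%:E * sqnorm e)%E.
  move=> kk_ge0 kk_rows; have c_ge0 (x : T) : 0 <= c.
    rewrite -(pmulr_lge0 _ (h_gt0 x)) -lee_fin; apply: le_trans (kk_rows x).
    by apply: esum_ge0 => y _; rewrite lee_fin mulr_ge0// ltW.
  apply: (@le_trans _ _ (\esum_(x in [set: T]) ((c / 2)%:E * (e x ^+ 2)%:E))%E).
    apply: le_esum => x _; under eq_esum do rewrite EFinM.
    rewrite esumZl//; last by move=> y; rewrite lee_fin mulr_ge0// ltW.
    apply: (@le_trans _ _ ((A e x)%:E * (c * h x)%:E)%E).
      by rewrite lee_wpmul2l ?lee_fin.
    have AE : A e x * (c * h x) = c / 2 * e x ^+ 2 by rewrite /A; field; rewrite gt_eqF.
    by rewrite -!EFinM AE.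
  have [[x _]|noT] := pselect (exists x : T, True).
    by rewrite esumZl ?divr_ge0 ?(c_ge0 x)// => y; rewrite lee_fin sqr_ge0.
  rewrite /sqnorm !esum1 ?mule0// => x; by case: noT; exists x.
apply: (@le_trans _ _ (\esum_(x in [set: T]) \esum_(y in [set: T])
    ((A f x * (k x y * h y))%:E + (A g y * (k x y * h x))%:E))%E).
  apply: le_esum => x _; apply: le_esum => y _.
  rewrite -EFinD lee_fin -subr_ge0 /A.
  have -> : f x ^+ 2 / (2 * h x) * (k x y * h y) + g y ^+ 2 / (2 * h y) * (k x y * h x)
     - k x y * f x * g y = k x y * h x * h y / 2 * (f x / h x - g y / h y) ^+ 2.
    by field; rewrite !gt_eqF.
  by rewrite mulr_ge0 ?sqr_ge0// divr_ge0// !mulr_ge0// ltW.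
have B_ge0 e (kk : T -> T -> R) x y z : (forall x y, 0 <= kk x y) ->
   (0 <= (A e x * (kk y z * h y))%:E)%E /\ (0 <= (A e x * (kk y z * h z))%:E)%E.
  by move=> kk_ge0; split; rewrite lee_fin (mulr_ge0 (A_ge0 _ _))// mulr_ge0// ltW.
under eq_esum => x _.
  rewrite esumD; last 2 first.
  - by move=> y _; apply: (B_ge0 _ k _ _ _ k_ge0).2.
  - by move=> y _; apply: (B_ge0 _ k _ _ _ k_ge0).1.
  over.
rewrite esumD; last 2 first.
- by move=> x _; apply: esum_ge0 => y _; apply: (B_ge0 _ k _ _ _ k_ge0).2.
- by move=> x _; apply: esum_ge0 => y _; apply: (B_ge0 _ k _ _ _ k_ge0).1.
rewrite ge0_muleDr ?sqnorm_ge0// leeD//; first exact: half.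
rewrite esum_exchange; last by move=> x y; apply: (B_ge0 _ k _ _ _ k_ge0).1.
exact: (half (fun y x => k x y)).
Qed.

Lemma form_boundD k k1 k2 c1 c2 :
  (forall x y, 0 <= k1 x y) -> (forall x y, 0 <= k2 x y) ->
  (forall x y, k x y = k1 x y + k2 x y) ->
  form_bound k1 c1 -> form_bound k2 c2 -> 0 <= c1 -> 0 <= c2 -> form_bound k (c1 + c2).
Proof.
move=> k1_ge0 k2_ge0 kE b1 b2 c1_ge0 c2_ge0 f g f_ge0 g_ge0.
have ge0 (kk : T -> T -> R) x y : (forall x y, 0 <= kk x y) ->
    (0 <= (kk x y * f x * g y)%:E)%E.
  by move=> kk_ge0; rewrite lee_fin !mulr_ge0.
under eq_esum => x _.
  under eq_esum do rewrite kE !mulrDl EFinD.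
  rewrite esumD; [|by move=> y _; apply: ge0..].
  over.
rewrite esumD; [|by move=> x _; apply: esum_ge0 => y _; apply: ge0..].
rewrite mulrDl EFinD ge0_muleDl ?lee_fin ?divr_ge0//.
by apply: leeD; [exact: b1 | exact: b2].
Qed.

(** With f = k g the form bound reads |f|^2 <= c/2 (|f|^2 + |g|^2). *)
Lemma form_bound_contraction k c f g : form_bound k c -> c < 2 ->
  (forall x y, 0 <= k x y) ->
  (forall x, 0 <= f x) -> (forall x, 0 <= g x) ->
  (forall x, (f x)%:E = (\esum_(y in [set: T]) (k x y * g y)%:E)%E) ->
  sqnorm f \is a fin_num -> sqnorm g \is a fin_num ->
  fine (sqnorm f) <= c / (2 - c) * fine (sqnorm g).
Proof.
move=> kc c2 k_ge0 f_ge0 g_ge0 fE fin_f fin_g.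
have : (sqnorm f <= (c / 2)%:E * (sqnorm f + sqnorm g))%E.
  apply: le_trans (kc f g f_ge0 g_ge0); apply: le_esum => x _.
  rewrite expr2 EFinM {2}fE -esumZl//; last by move=> y; rewrite lee_fin mulr_ge0.
  by apply: le_esum => y _; rewrite -EFinM lee_fin mulrCA mulrA.
rewrite -(fineK fin_f) -(fineK fin_g) -EFinD -EFinM lee_fin /= => le_f.
rewrite mulrAC ler_pdivlMr; lra.
Qed.

End FormBounds.

Section SpectralRadius.
Variables (R : realType) (T : choiceType) (p : T -> T -> R).
Hypothesis transp : is_transition_matrix p.
Local Open Scope classical_set_scope.
Local Open Scope ring_scope.
Hypothesis colp : forall y, (\esum_(x in [set: T]) (p x y)%:E <= 1)%E.

Definition nstep (n : nat) (x y : T) : R := fine (transition_iter p n x y).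

Lemma transition_ge0 x y : 0 <= p x y. Proof. exact: transp.1. Qed.

Lemma transition_iter_bounds n x y :
  (0 <= transition_iter p n x y)%E /\ (transition_iter p n x y <= 1)%E.
Proof.
elim: n x => [|n IH] x /=; first by rewrite !lee_fin ler0n lern1 leq_b1.
have ge0 z : (0 <= (p x z)%:E * transition_iter p n z y)%E.
  by rewrite mule_ge0 ?lee_fin ?transition_ge0// (IH z).1.
split; first by apply: esum_ge0.
rewrite -(transp.2 x); apply: le_esum => z _.
by rewrite -[leRHS]mule1 lee_wpmul2l ?lee_fin ?transition_ge0// (IH z).2.
Qed.

Lemma nstepE n x y : (nstep n x y)%:E = transition_iter p n x y.
Proof.
have [ge0 le1] := transition_iter_bounds n x y.
by rewrite /nstep fineK// fin_real// (lt_le_trans _ ge0)//= (le_lt_trans le1)// ltry.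
Qed.

Lemma nstep_ge0 n x y : 0 <= nstep n x y.
Proof. by rewrite -lee_fin nstepE (transition_iter_bounds _ _ _).1. Qed.

Lemma nstep_le1 n x y : nstep n x y <= 1.
Proof. by rewrite -lee_fin nstepE (transition_iter_bounds _ _ _).2. Qed.

Lemma nstep0 x y : nstep 0 x y = (x == y)%:R. Proof. by []. Qed.

Lemma nstepS n x y :
  (nstep n.+1 x y)%:E = (\esum_(z in [set: T]) (p x z * nstep n z y)%:E)%E.
Proof. by rewrite nstepE /=; apply: eq_esum => z _; rewrite EFinM nstepE. Qed.

Lemma nstep_add n k x y :
  (nstep (n + k) x y)%:E = (\esum_(z in [set: T]) (nstep n x z * nstep k z y)%:E)%E.
Proof.
elim: n x => [|n IH] x.
  rewrite (esum_single (z := x)) ?nstep0 ?eqxx ?mul1r ?lee_fin ?nstep_ge0//.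
  by move=> z /eqP; rewrite eq_sym => /negbTE zx; rewrite nstep0 zx mul0r.
rewrite addSn nstepS.
have ge0 z u : 0 <= p x z * nstep n z u * nstep k u y.
  by rewrite !mulr_ge0 ?transition_ge0 ?nstep_ge0.
transitivity (\esum_(z in [set: T]) \esum_(u in [set: T])
    (p x z * nstep n z u * nstep k u y)%:E)%E.
  apply: eq_esum => z _; rewrite EFinM IH -esumZl ?transition_ge0//.
    by apply: eq_esum => u _; rewrite -EFinM mulrA.
  by move=> u; rewrite lee_fin mulr_ge0 ?nstep_ge0.
rewrite esum_exchange; last by move=> z u; rewrite lee_fin.
apply: eq_esum => u _; rewrite [in RHS]mulrC EFinM nstepS -esumZl ?nstep_ge0//.
  by apply: eq_esum => z _; rewrite -EFinM mulrC.
by move=> z; rewrite lee_fin mulr_ge0 ?nstep_ge0 ?transition_ge0.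
Qed.

Lemma nstep_row n x : (\esum_(y in [set: T]) (nstep n x y)%:E = 1)%E.
Proof.
elim: n x => [|n IH] x.
  rewrite (esum_single (z := x)) ?nstep0 ?eqxx// ?lee_fin// => z /eqP.
  by rewrite eq_sym => /negbTE zx; rewrite nstep0 zx.
under eq_esum do rewrite nstepS.
rewrite esum_exchange; last first.
  by move=> y z; rewrite lee_fin mulr_ge0 ?nstep_ge0 ?transition_ge0.
rewrite -(transp.2 x); apply: eq_esum => z _; under eq_esum do rewrite EFinM.
by rewrite esumZl ?transition_ge0 ?IH ?mule1// => y; rewrite lee_fin nstep_ge0.
Qed.

Lemma nstep_col n y : (\esum_(x in [set: T]) (nstep n x y)%:E <= 1)%E.
Proof.
elim: n y => [|n IH] y.
  rewrite (esum_single (z := y)) ?nstep0 ?eqxx// ?lee_fin// => z /eqP.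
  by move=> /negbTE zy; rewrite nstep0 zy.
under eq_esum do rewrite nstepS.
rewrite esum_exchange; last first.
  by move=> x z; rewrite lee_fin mulr_ge0 ?nstep_ge0 ?transition_ge0.
apply: le_trans (IH y); apply: le_esum => z _.
under eq_esum do rewrite mulrC EFinM.
rewrite esumZl ?nstep_ge0//; last by move=> x; rewrite lee_fin transition_ge0.
by rewrite -[leRHS]mule1 lee_wpmul2l ?lee_fin ?nstep_ge0.
Qed.

Lemma nstep_sqnorm n y : (sqnorm (fun x => nstep n x y) <= 1)%E.
Proof.
apply: le_trans (nstep_col n y); apply: le_esum => x _.
by rewrite lee_fin expr2 ler_piMr ?nstep_ge0 ?nstep_le1.
Qed.

Let E n y : R := fine (sqnorm (fun x => nstep n x y)).

Lemma nstep_sqnorm_fin n y : sqnorm (fun x => nstep n x y) \is a fin_num.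
Proof.
rewrite fin_real// (lt_le_trans _ (sqnorm_ge0 _))//=.
by rewrite (le_lt_trans (nstep_sqnorm n y))// ltry.
Qed.

Lemma nstep_contraction N n c y : form_bound (nstep N) c -> c < 2 ->
  E (N + n) y <= c / (2 - c) * E n y.
Proof.
move=> Nc c2; apply: (form_bound_contraction (k := nstep N)) => //;
  try by move=> *; apply: nstep_ge0.
all: by [exact: nstep_sqnorm_fin | move=> x; exact: nstep_add].
Qed.

(** A column of P^n has squared l^2-norm at most r^(n / N) with r < 1, and each
    of its entries is at most the norm. *)
Lemma spectral_radius_lt1 N c : (0 < N)%N -> form_bound (nstep N) c -> 0 <= c < 1 ->
  forall x y, (spectral_radius p x y < 1)%E.
Proof.
move=> N_gt0 Nc /andP[c_ge0 c_lt1] x y.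
pose r := c / (2 - c).
have r_ge0 : 0 <= r by rewrite divr_ge0//; lra.
have r_lt1 : r < 1 by rewrite /r ltr_pdivrMr; lra.
have E_ge0 n : 0 <= E n y by rewrite fine_ge0 ?sqnorm_ge0.
have E_le1 n : E n y <= 1.
  by rewrite -lee_fin fineK ?nstep_sqnorm_fin ?nstep_sqnorm.
have E_step j n : E (j * N + n)%N y <= r ^+ j.
  elim: j => [|j IH]; first by rewrite expr0.
  rewrite mulSn -addnA; apply: le_trans (nstep_contraction _ _ Nc _) _; first lra.
  by rewrite exprS ler_wpM2l.
have decay n : nstep n x y ^+ 2 <= r ^+ (n %/ N).
  apply: (@le_trans _ _ (E n y)); last by rewrite {1}(divn_eq n N).
  rewrite -lee_fin fineK ?nstep_sqnorm_fin//.
  by apply: (@esum_ge_term _ _ x) => z; rewrite lee_fin sqr_ge0.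
(* Since n <= 2 N (n / N) for n >= N, the choice t^(4 N) = r gives r^(n / N) <=
   t^(2 n). *)
pose t := r `^ ((4 * N)%:R^-1).
have t_ge0 : 0 <= t by apply: powR_ge0.
have tX : t ^+ (4 * N) = r.
  rewrite -powR_mulrn// -powRrM mulVf ?powRr1// pnatr_eq0; lia.
have t_lt1 : t < 1.
  by rewrite ltNge; apply/negP => /(exprn_ege1 (4 * N)); rewrite tX leNgt r_lt1.
have nstep_le n : (N <= n)%N -> nstep n x y <= t ^+ n.
  move=> le_Nn; rewrite -(@ler_pXn2r _ 2)// ?nnegrE ?nstep_ge0 ?exprn_ge0//.
  apply: le_trans (decay n) _; rewrite -tX -!exprM ler_wiXn2l// ?(ltW t_lt1)//.
  rewrite -mulnA (mulnC N) {1}(divn_eq n N).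
  have : (N <= n %/ N * N)%N by rewrite leq_pmull// divn_gt0.
  have := ltn_pmod n N_gt0; move: (n %/ N * N)%N (n %% N)%N => a b; clear; lia.
apply: (@le_lt_trans _ _ t%:E); last by rewrite lte_fin.
apply: (@le_trans _ _ (ereal_sup
    ((fun n => transition_iter p n x y `^ (n%:R^-1))%E @` [set n | (N <= n)%N]))).
  by apply: ereal_inf_lbound; exists [set n | (N <= n)%N] => //; exists N.
apply: ge_ereal_sup => _ [n /= le_Nn <-].
rewrite -nstepE poweR_EFin lee_fin.
have n_neq0 : n%:R != 0 :> R by rewrite pnatr_eq0; lia.
apply: (@le_trans _ _ ((t ^+ n) `^ n%:R^-1)).
  by apply: ge0_ler_powR; rewrite ?nnegrE ?invr_ge0 ?nstep_ge0 ?exprn_ge0 ?nstep_le.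
by rewrite -powR_mulrn// -powRrM mulfV// powRr1.
Qed.

End SpectralRadius.

(** * Weyl distances and sphere sizes in a regular thick building *)

Section Buildings.
Variables (S : finType) (W : groupType) (gen : S -> W).
Variable m : S -> S -> option nat.
Hypothesis coxW : is_coxeter_system gen m.
Variables (Delta : choiceType) (delta : Delta -> Delta -> W) (q : S -> nat).
Hypothesis bld : is_building gen delta.
Hypothesis reg : is_regular gen delta q.
Hypothesis thickq : is_thick q.
Local Notation ascent := (ascent gen).

Lemma delta_refl x : delta x x = 1%g.
Proof. exact/(building_B1 bld). Qed.

Lemma adjacent_sym x y s : delta x y = gen s -> delta y x = gen s.
Proof.
move=> xy; have [z [yz xz]] := building_B3 bld s xy.
by move: xz; rewrite (gen_sqr coxW) => /(building_B1 bld) ->.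
Qed.

Lemma panel_adjacent x y z s : delta y x = gen s -> delta y z = gen s ->
  x = z \/ delta x z = gen s.
Proof.
move=> /adjacent_sym xy yz; have [[|] xz _] := building_B2 bld xy yz.
- by right.
- by left; apply/(building_B1 bld); rewrite xz (gen_sqr coxW).
Qed.

Lemma delta_ascent x y z w s : ascent w s -> delta x y = w -> delta y z = gen s ->
  delta x z = (w * gen s)%g.
Proof. by move=> ws xy yz; apply: (building_B2 bld xy yz).2; apply: ascentP. Qed.

(** The chamber [z0] is the projection of [x] to the s-panel of [y]. *)
Lemma delta_descent x y w s : ~~ ascent w s -> delta x y = w ->
  exists z0, [/\ delta y z0 = gen s, delta x z0 = (w * gen s)%g &
    forall z, delta y z = gen s -> z <> z0 -> delta x z = w].
Proof.
move=> ws xy; have [z0 [yz0 xz0]] := building_B3 bld s xy.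
exists z0; split=> // z yz zz0; have [z0z|z0z] := panel_adjacent yz0 yz.
  by case: zz0.
rewrite (delta_ascent _ xz0 z0z) ?(mul_genK coxW)//.
by rewrite (ascent_mul coxW).
Qed.

Lemma delta_surj x w : exists y, delta x y = w.
Proof.
elim/(reduced_ind coxW): w => [|w s _ [y xy]].
  by exists x; apply: delta_refl.
by have [z [_ xz]] := building_B3 bld s xy; exists z.
Qed.

Lemma panel_enum x s : exists u : seq Delta,
  [/\ uniq u, size u = q s & forall y, (y \in u) <-> delta x y = gen s].
Proof.
have card_panel := reg s x.
have fin : finite_set [set y | delta x y = gen s]%classic.
  by apply/finite_setP; exists (q s).
exists (finmap.enum_fset (fset_set [set y | delta x y = gen s]%classic)); split.
- exact: finmap.fset_uniq.
- exact: card_fset_set.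
- by move=> y; rewrite in_fset_set// in_setE.
Qed.

Lemma exists_other_neighbour x y s : exists z, delta x z = gen s /\ z <> y.
Proof.
have [u [u_uniq u_size uP]] := panel_enum x s.
case: u u_uniq u_size uP => [|a [|b u]]; rewrite /= ?inE.
- by move=> _ q0; have := thickq s; rewrite -q0.
- by move=> _ q1; have := thickq s; rewrite -q1.
rewrite negb_or => /andP[/andP[/eqP ab _] _] _ uP.
have [<-|ay] := pselect (a = y).
  by exists b; split; [apply/uP; rewrite !inE eqxx orbT | move=> ba; case: ab].
by exists a; split => //; apply/uP; rewrite inE eqxx.
Qed.

(** Chambers at the same Weyl distance from a base chamber have neighbours of
    each type at the same Weyl distances. Thickness matters at a descent, where
    some neighbour other than the projection has to exist. *)
Lemma neighbour_transfer x0 y0 z0 x y s : delta x y = delta x0 y0 ->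
  delta y0 z0 = gen s -> exists z, delta y z = gen s /\ delta x z = delta x0 z0.
Proof.
move=> xy y0z0; have [[x0z0|x0z0] asc] := building_B2 bld (erefl (delta x0 y0)) y0z0.
  have [ws|ws] := boolP (ascent (delta x0 y0) s).
    by have := asc (ascentP ws); rewrite x0z0 => /esym/(mul_gen_neq coxW).
  have [a [ya xa others]] := delta_descent ws xy.
  have [z [yz za]] := exists_other_neighbour y a s.
  by exists z; split=> //; rewrite others.
have [z [yz xz]] := building_B3 bld s xy.
by exists z; rewrite yz xz x0z0.
Qed.

(** Follow a minimal gallery from [y0] back to [z0], one neighbour at a time. *)
Lemma delta_transfer x0 y0 z0 x y : delta x y = delta x0 y0 ->
  exists z, delta x z = delta x0 z0 /\ delta z y = delta z0 y0.
Proof.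
move Ew: (delta z0 y0) => w.
elim/(reduced_ind coxW): w x0 y0 z0 x y Ew => [|w s ws IH] x0 y0 z0 x y.
  move=> /(building_B1 bld) -> xy; exists y.
  by rewrite delta_refl xy.
move=> z0y0 xy; have [y0' [y0y0' z0y0']] := building_B3 bld s z0y0.
rewrite (mul_genK coxW) in z0y0'.
have [y' [yy' xy']] := neighbour_transfer xy y0y0'.
have [z [xz zy']] := IH _ _ _ _ _ z0y0' xy'.
by exists z; split=> //; apply: (delta_ascent ws zy'); apply: adjacent_sym.
Qed.

Section Counting.
Variable R : realType.
Local Open Scope classical_set_scope.
Local Open Scope ring_scope.

Definition sphere (w : W) (x y : Delta) : R := (`[< delta x y = w >])%:R.

Lemma sphere_ge0 w x y : 0 <= sphere w x y.
Proof. exact: ler0n. Qed.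

Lemma sphere_in w x y : delta x y = w -> sphere w x y = 1.
Proof. by move=> xy; rewrite /sphere asboolT. Qed.

Lemma sphere_notin w x y : delta x y <> w -> sphere w x y = 0.
Proof. by move=> xy; rewrite /sphere asboolF. Qed.

Lemma sphere_gen_sym s x y : sphere (gen s) x y = sphere (gen s) y x.
Proof.
rewrite /sphere; congr (nat_of_bool _)%:R.
by apply: asbool_equiv_eq; split; apply: adjacent_sym.
Qed.

Lemma panel_sum x s (u : seq Delta) (F : Delta -> R) : uniq u ->
  (forall y, (y \in u) <-> delta x y = gen s) -> (forall y, 0 <= F y) ->
  (\esum_(y in [set: Delta]) (sphere (gen s) x y * F y)%:E = (\sum_(y <- u) F y)%:E)%E.
Proof.
move=> u_uniq uP F_ge0.
have fin : finite_set [set` u] by exact: finite_seq.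
rewrite -sumEFin (fsbig_seq _ _ u_uniq) -esum_fset//; last first.
  by move=> i _; rewrite lee_fin.
rewrite [RHS]esum_mkcond; apply: eq_esum => y _.
case: ifPn => [|/negP]; rewrite in_setE /= => /uP xy.
  by rewrite sphere_in ?mul1r.
by rewrite sphere_notin ?mul0r// => /uP.
Qed.

Lemma panel_count x s :
  (\esum_(y in [set: Delta]) (sphere (gen s) x y)%:E = ((q s)%:R : R)%:E)%E.
Proof.
have [u [u_uniq <- uP]] := panel_enum x s.
under eq_esum do rewrite -[sphere _ _ _]mulr1.
by rewrite (panel_sum u_uniq uP)// big_const_seq count_predT iter_addr_0.
Qed.

Lemma radial_panel_sum o x s (f : W -> R) : (forall w, 0 <= f w) ->
  (\esum_(y in [set: Delta]) (sphere (gen s) x y * f (delta o y))%:E =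
   ((q s)%:R * (f (delta o x) + move_prob R gen q (delta o x) s *
      (f (delta o x * gen s)%g - f (delta o x))))%:E)%E.
Proof.
move=> f_ge0; have [u [u_uniq u_size uP]] := panel_enum x s.
rewrite (panel_sum u_uniq uP)//; congr EFin.
have q_neq0 : (q s)%:R != 0 :> R by rewrite pnatr_eq0; have := thickq s; lia.
rewrite /move_prob; case: ifPn => ws.
  rewrite (eq_big_seq (fun=> f (delta o x * gen s)%g)); last first.
    by move=> y /uP xy; rewrite (delta_ascent ws _ xy).
  by rewrite big_const_seq count_predT iter_addr_0 u_size -mulr_natl; ring.
have [z0 [xz0 oz0 others]] := delta_descent ws (erefl (delta o x)).
have uz0 : z0 \in u by apply/uP.
pose d := f (delta o x * gen s)%g - f (delta o x).
rewrite (eq_big_seq (fun y => f (delta o x) + (if y == z0 then d else 0))).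
  rewrite big_split /= big_const_seq count_predT iter_addr_0 u_size.
  rewrite (bigD1_seq z0)//= eqxx.
  rewrite big1_seq ?addr0; last by move=> y /andP[/negbTE ->].
  by rewrite -/d -mulr_natl; field.
move=> y /uP xy; case: eqVneq => [->|/eqP yz0]; first by rewrite oz0 /d; ring.
by rewrite others ?addr0.
Qed.

(** Above an ascent, a chamber at distance w s has exactly one s-neighbour at
    distance w. *)
Lemma sphere_ascent w s x y : ascent w s -> (sphere (w * gen s)%g x y)%:E =
  (\esum_(z in [set: Delta]) (sphere w x z * sphere (gen s) z y)%:E)%E.
Proof.
move=> ws; have ge0 z : 0 <= sphere w x z * sphere (gen s) z y.
  by rewrite mulr_ge0 ?sphere_ge0.
have [xy|xy] := pselect (delta x y = (w * gen s)%g); last first.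
  rewrite sphere_notin// esum1// => z _.
  have [xz|xz] := pselect (delta x z = w); last by rewrite sphere_notin ?mul0r.
  rewrite mulrC sphere_notin ?mul0r// => zy; apply: xy.
  exact: delta_ascent xz zy.
rewrite sphere_in//; have ws' : ~~ ascent (w * gen s)%g s.
  by rewrite (ascent_mul coxW) negbK.
have [z0 [yz0 xz0 others]] := delta_descent ws' xy.
rewrite (mul_genK coxW) in xz0.
rewrite (esum_single (z := z0)) ?lee_fin//.
  by rewrite !sphere_in ?mulr1//; apply: adjacent_sym.
move=> z zz0; have [zy|zy] := pselect (delta z y = gen s).
  rewrite sphere_notin ?mul0r// (others z _ zz0); last exact: adjacent_sym.
  exact: (mul_gen_neq coxW).
by rewrite mulrC sphere_notin ?mul0r.
Qed.

(** Both counts are the product of the parameters q along a reduced word. *)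
Lemma sphere_count w : exists2 c : R, 0 <= c &
  (forall x, \esum_(y in [set: Delta]) (sphere w x y)%:E = c%:E)%E /\
  (forall y, \esum_(x in [set: Delta]) (sphere w x y)%:E = c%:E)%E.
Proof.
elim/(reduced_ind coxW): w => [|w s ws [c c_ge0 [rows cols]]].
  exists 1 => //; split=> x; rewrite (esum_single (z := x)) ?lee_fin ?sphere_ge0//.
  - by rewrite sphere_in// delta_refl.
  - by move=> y yx; rewrite sphere_notin// => /(building_B1 bld)/esym.
  - by rewrite sphere_in// delta_refl.
  - by move=> y yx; rewrite sphere_notin// => /(building_B1 bld).
have ge0 x z y : (0 <= (sphere w x z * sphere (gen s) z y)%:E)%E.
  by rewrite lee_fin mulr_ge0 ?sphere_ge0.
exists (c * (q s)%:R); first by rewrite mulr_ge0.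
split=> [x|y].
  under eq_esum do rewrite sphere_ascent//.
  rewrite esum_exchange//.
  transitivity (\esum_(z in [set: Delta]) ((q s)%:R%:E * (sphere w x z)%:E))%E.
    apply: eq_esum => z _; under eq_esum do rewrite EFinM.
    rewrite esumZl ?sphere_ge0//; last by move=> y; rewrite lee_fin sphere_ge0.
    by rewrite panel_count muleC.
  rewrite esumZl ?rows//; last by move=> z; rewrite lee_fin sphere_ge0.
  by rewrite -EFinM mulrC.
under eq_esum do rewrite sphere_ascent//.
rewrite esum_exchange//.
transitivity (\esum_(z in [set: Delta]) (c%:E * (sphere (gen s) y z)%:E))%E.
  apply: eq_esum => z _; under eq_esum do rewrite mulrC EFinM.
  rewrite esumZl ?sphere_ge0//; last by move=> x; rewrite lee_fin sphere_ge0.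
  by rewrite cols muleC sphere_gen_sym.
rewrite esumZl//; last by move=> z; rewrite lee_fin sphere_ge0.
by rewrite panel_count -EFinM.
Qed.

(** Grouped by Weyl distance, row and column sums are the same weighted sum over
    W by [sphere_count]. *)
Lemma isotropic_column_sum (p : Delta -> Delta -> R) :
  (forall x y, 0 <= p x y) -> is_isotropic p delta -> forall x y,
  (\esum_(z in [set: Delta]) (p z y)%:E = \esum_(z in [set: Delta]) (p x z)%:E)%E.
Proof.
move=> p_ge0 iso x y.
have /choice[r rP] : forall w, exists z, delta x z = w by apply: delta_surj.
pose a w := p x (r w).
have pE u v : (p u v)%:E = (\esum_(w in [set: W]) (a w * sphere w u v)%:E)%E.
  have ge0 w : (0 <= (a w * sphere w u v)%:E)%E.
    by rewrite lee_fin mulr_ge0 ?sphere_ge0 ?p_ge0.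
  rewrite (esum_single (z := delta u v))// ?(sphere_in (erefl (delta u v))) ?mulr1.
    by congr EFin; apply: iso; rewrite rP.
  by move=> w wuv; rewrite sphere_notin ?mulr0// => /esym.
have ge0 w u v : (0 <= (a w * sphere w u v)%:E)%E.
  by rewrite lee_fin mulr_ge0 ?sphere_ge0 ?p_ge0.
under eq_esum do rewrite pE; under [RHS]eq_esum do rewrite pE.
rewrite !(esum_exchange (T2 := W))//; apply: eq_esum => w _.
have [c c_ge0 [rows cols]] := sphere_count w.
under eq_esum do rewrite EFinM; under [RHS]eq_esum do rewrite EFinM.
rewrite !esumZl ?p_ge0//; try by move=> z; rewrite lee_fin sphere_ge0.
by rewrite rows cols.
Qed.

End Counting.
End Buildings.

(** * The nearest neighbour kernel contracts *)

Lemma expRN_le (R : realType) (z : R) :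
  (`|z| <= 2^-1 -> expR (- z) <= 1 - z + 2 * z ^+ 2)%R.
Proof.
rewrite ler_norml => /andP[z1 z2]; have z3 : (0 < 1 + z)%R by lra.
apply: (@le_trans _ _ (1 + z)^-1%R).
  by rewrite expRN lef_pV2 ?posrE ?expR_gt0// expR_ge1Dx.
rewrite -[leLHS]mul1r ler_pdivrMr//.
have -> : ((1 - z + 2 * z ^+ 2) * (1 + z) = 1 + z ^+ 2 * (1 + 2 * z))%R by ring.
by rewrite lerDl mulr_ge0 ?sqr_ge0//; lra.
Qed.

Section IsotropicWalks.
Variables (R : realType) (S : finType) (W : groupType) (gen : S -> W).
Variable m : S -> S -> option nat.
Hypothesis coxW : is_coxeter_system gen m.
Variables (Delta : choiceType) (delta : Delta -> Delta -> W) (q : S -> nat).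
Hypothesis bld : is_building gen delta.
Hypothesis reg : is_regular gen delta q.
Hypothesis thickq : is_thick q.
Local Open Scope classical_set_scope.
Local Open Scope ring_scope.

Section Adjacency.
Variables (J : {set S}) (phi : W -> R) (C : R).
Hypothesis J_gt0 : (0 < #|J|)%N.
Hypothesis C_ge1 : 1 <= C.
Hypothesis phiP : forall w, 1 <= drift gen q J phi w /\
  forall s, `|phi (w * gen s)%g - phi w| <= C.

(** The transition matrix of the walk that picks a type in [J] and then a
    neighbour of this type, both uniformly. *)
Definition adjacency (x y : Delta) : R :=
  #|J|%:R^-1 * \sum_(s in J) (q s)%:R^-1 * sphere delta R (gen s) x y.

Let n : R := #|J|%:R.
Let n_ge1 : 1 <= n. Proof. by rewrite ler1n. Qed.

Let q_gt0 s : 0 < (q s)%:R :> R.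
Proof. by rewrite ltr0n ltnW// thickq. Qed.

Lemma adjacency_ge0 x y : 0 <= adjacency x y.
Proof.
rewrite mulr_ge0 ?invr_ge0 ?ler0n// sumr_ge0// => s _.
by rewrite mulr_ge0 ?invr_ge0 ?ler0n ?sphere_ge0.
Qed.

Lemma adjacency_sym x y : adjacency x y = adjacency y x.
Proof.
congr (_ * _); apply: eq_bigr => s _.
by rewrite (sphere_gen_sym coxW bld).
Qed.

Lemma adjacency_radial_sum o x (f : W -> R) : (forall w, 0 <= f w) ->
  (\esum_(y in [set: Delta]) (adjacency x y * f (delta o y))%:E =
   (f (delta o x) + n^-1 * drift gen q J f (delta o x))%:E)%E.
Proof.
move=> f_ge0; have nq_ge0 s : 0 <= n^-1 * (q s)%:R^-1.
  by rewrite mulr_ge0 ?invr_ge0 ?ler0n.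
have sf_ge0 s y : 0 <= sphere delta R (gen s) x y * f (delta o y).
  by rewrite mulr_ge0 ?sphere_ge0.
transitivity (\esum_(y in [set: Delta]) \sum_(s in J)
    ((n^-1 * (q s)%:R^-1)%:E * (sphere delta R (gen s) x y * f (delta o y))%:E))%E.
  apply: eq_esum => y _; under [RHS]eq_bigr do rewrite -EFinM.
  rewrite sumEFin; congr EFin; rewrite /adjacency -mulrA mulr_suml mulr_sumr.
  by apply: eq_bigr => s _; rewrite !mulrA.
rewrite esum_sum; last by move=> y s _ _; rewrite mule_ge0 ?lee_fin.
under eq_bigr => s _.
  rewrite esumZl//; last by move=> y; rewrite lee_fin.
  rewrite (radial_panel_sum coxW bld reg thickq)// -EFinM -mulrA.
  rewrite (mulKf (lt0r_neq0 (q_gt0 s))).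
  over.
rewrite sumEFin -mulr_sumr big_split /= sumr_const -[_ *+ #|J|]mulr_natl mulrDr mulKf//.
by rewrite gt_eqF// (lt_le_trans _ n_ge1).
Qed.

(** For small a > 0 and h = exp (- a phi), the first order term of the ratio of
    the sum to h x is - a / n times the drift of phi, and the second order term
    is at most 2 a^2 C^2, which is a / (2 n) for the value chosen here. *)
Lemma adjacency_contraction : exists2 c : R, 0 <= c < 1 &
  exists2 h : Delta -> R, (forall x, 0 < h x) &
    forall x, (\esum_(y in [set: Delta]) (adjacency x y * h y)%:E <= (c * h x)%:E)%E.
Proof.
have [base _] := building_nonempty bld.
have n1 := n_ge1.
have C1 := C_ge1.
pose a : R := (4 * C ^+ 2 * n)^-1.
have C2 : 1 <= C ^+ 2 by rewrite exprn_ege1.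
have C2n : 1 <= C ^+ 2 * n by rewrite mulr_ege1.
have a_gt0 : 0 < a by rewrite invr_gt0 -mulrA; lra.
have aE : a * (4 * C ^+ 2 * n) = 1 by rewrite mulVf// -mulrA gt_eqF//; lra.
have a_le : a <= 4^-1 by rewrite lef_pV2 ?posrE// -mulrA; lra.
have aC : a * C <= 2^-1.
  have : a * C <= a * (C ^+ 2 * n).
    rewrite ler_wpM2l ?(ltW a_gt0)// expr2 -mulrA ler_peMr ?mulr_ege1//; lra.
  lra.
pose f w := expR (- (a * phi w)).
exists (1 - a / 2 / n).
  have : 0 < a / 2 / n <= a / 2.
    have n0 : 0 < n by lra.
    by rewrite !divr_gt0//= ler_pdivrMr// ler_peMr// divr_ge0// ltW.
  by move=> /andP[? ?]; apply/andP; split; lra.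
exists (fun x => f (delta base x)) => [x|x]; first exact: expR_gt0.
rewrite adjacency_radial_sum => [|w]; last exact: expR_ge0.
rewrite lee_fin mulrBl mul1r lerD2l -(ler_pM2l (_ : 0 < n)); last lra.
rewrite mulrA divff ?mul1r; last by rewrite gt_eqF//; lra.
have -> : n * - (a / 2 / n * f (delta base x)) = - (a / 2) * f (delta base x).
  by field; rewrite gt_eqF//; lra.
move: (delta base x) => w; have [drift_ge1 incr] := phiP w.
have step s : move_prob R gen q w s * (f (w * gen s)%g - f w) <=
    f w * (- a * (move_prob R gen q w s * (phi (w * gen s)%g - phi w)) +
           2 * a ^+ 2 * C ^+ 2).
  set d := phi (w * gen s)%g - phi w.
  have fE : f (w * gen s)%g = f w * expR (- (a * d)).
    by rewrite -expRD; congr expR; rewrite /d; ring.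
  have p0 := move_prob_gt0 R gen thickq w s.
  have p1 := move_prob_le1 R gen thickq w s.
  have dC : `|d| <= C by exact: incr.
  have d2C : d ^+ 2 <= C ^+ 2.
    by rewrite -real_normK ?num_real// lerXn2r ?nnegrE// (le_trans _ C_ge1).
  have le_exp : expR (- (a * d)) <= 1 - a * d + 2 * (a * d) ^+ 2.
    apply: expRN_le; rewrite normrM gtr0_norm//; apply: le_trans aC.
    by rewrite ler_wpM2l ?(ltW a_gt0).
  rewrite fE -[X in _ - X]mulr1 -mulrBr mulrCA ler_wpM2l ?expR_ge0//.
  apply: (@le_trans _ _ (move_prob R gen q w s * (- (a * d) + 2 * (a * d) ^+ 2))).
    by rewrite ler_wpM2l ?(ltW p0)//; lra.
  rewrite mulrDr lerD//; first by rewrite mulrN mulNr mulrCA.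
  apply: (@le_trans _ _ (1 * (2 * a ^+ 2 * C ^+ 2))); last by rewrite mul1r.
  apply: ler_pM => //; [exact: ltW|by rewrite mulr_ge0 ?sqr_ge0|].
  by rewrite exprMn mulrA ler_wpM2l// mulr_ge0 ?sqr_ge0.
apply: le_trans (ler_sum _ (fun s _ => step s)) _.
rewrite -mulr_sumr big_split /= -mulr_sumr sumr_const -[_ *+ #|J|]mulr_natl -/n mulrC.
rewrite ler_wpM2r ?expR_ge0//.
have -> : n * (2 * a ^+ 2 * C ^+ 2) = a / 2 * (a * (4 * C ^+ 2 * n)) by field.
rewrite aE; move: drift_ge1; rewrite /drift; nra.
Qed.

End Adjacency.

End IsotropicWalks.

(** * Isotropic random walks *)

Section Walks.
Variables (R : realType) (S : finType) (W : groupType) (gen : S -> W).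
Variable m : S -> S -> option nat.
Hypothesis coxW : is_coxeter_system gen m.
Variables (Delta : choiceType) (delta : Delta -> Delta -> W) (q : S -> nat).
Hypothesis bld : is_building gen delta.
Hypothesis reg : is_regular gen delta q.
Hypothesis thickq : is_thick q.
Variable p : Delta -> Delta -> R.
Hypothesis transp : is_transition_matrix p.
Hypothesis isop : is_isotropic p delta.
Local Open Scope classical_set_scope.
Local Open Scope ring_scope.

(** Homogeneity of the building moves a path of positive probability from one
    pair of chambers to every other pair at the same Weyl distance. *)
Lemma nstep_lower_bound n x0 y0 : 0 < nstep p n x0 y0 ->
  exists2 e, 0 < e & forall x y, delta x y = delta x0 y0 -> e <= nstep p n x y.
Proof.
elim: n x0 => [|n IH] x0.
  rewrite nstep0; case: eqP => [->|_]; last by rewrite ltxx.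
  move=> _; exists 1 => // x y; rewrite (delta_refl bld) => /(building_B1 bld) ->.
  by rewrite nstep0 eqxx.
have ge0 x y z : (0 <= (p x z * nstep p n z y)%:E)%E.
  by rewrite lee_fin mulr_ge0 ?(transition_ge0 transp) ?(nstep_ge0 transp).
rewrite -lte_fin nstepS// => /esum_pos_exists[//|z0]; rewrite lte_fin => pos.
have pn : 0 < nstep p n z0 y0.
  rewrite lt_neqAle (nstep_ge0 transp) andbT eq_sym; apply: contraTneq pos => ->.
  by rewrite mulr0 ltxx.
have pp : 0 < p x0 z0 by rewrite -(pmulr_lgt0 _ pn).
have [e e_gt0 eP] := IH _ pn; exists (p x0 z0 * e); first exact: mulr_gt0.
move=> x y xy; have [z [xz zy]] := delta_transfer coxW bld reg thickq z0 xy.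
rewrite -lee_fin nstepS//; apply: le_trans (esum_ge_term z _) => //.
by rewrite lee_fin (isop xz) ler_wpM2l ?(transition_ge0 transp) ?eP.
Qed.

Lemma nstep_pos_add n k x z y : 0 < nstep p n x z -> 0 < nstep p k z y ->
  0 < nstep p (n + k) x y.
Proof.
move=> xz zy; rewrite -lte_fin nstep_add//.
apply: (@lt_le_trans _ _ (nstep p n x z * nstep p k z y)%:E).
  by rewrite lte_fin mulr_gt0.
by apply: (esum_ge_term z) => u; rewrite lee_fin mulr_ge0 ?(nstep_ge0 transp).
Qed.

Hypothesis irrp : is_irreducible p.

(** Thickness removes all parity obstructions: if the walk can cross an s-panel
    in n steps, then in 2 n steps it can both return and cross. Adding these
    times over all s gives a common time. *)
Lemma common_crossing_time : (0 < #|S|)%N -> exists2 N, (0 < N)%N &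
  forall s, exists2 e, 0 < e &
    forall x y, delta x y = gen s -> e <= nstep p N x y.
Proof.
move=> S_gt0; have [base _] := building_nonempty bld.
have /choice[t tP] : forall s, exists n, (0 < n)%N /\
    forall x y, delta x y = gen s -> 0 < nstep p n x y.
  move=> s; have [y0 xy0] := delta_surj coxW bld base (gen s).
  have [n [n_gt0]] := irrp base y0.
  rewrite -nstepE// lte_fin => /nstep_lower_bound[e e_gt0 eP].
  by exists n; split=> // x y xy; rewrite (lt_le_trans e_gt0)// eP// xy xy0.
have back s x : 0 < nstep p (t s + t s) x x.
  have [y xy] := delta_surj coxW bld x (gen s).
  apply: (@nstep_pos_add _ _ _ y); apply: (tP s).2 => //.
  exact: (adjacent_sym coxW bld xy).
have cross s x y : delta x y = gen s -> 0 < nstep p (t s + t s) x y.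
  move=> xy; have [z [xz zy]] := exists_other_neighbour reg thickq x y s.
  apply: (@nstep_pos_add _ _ _ z); apply: (tP s).2 => //.
  by have [] := panel_adjacent coxW bld xz xy.
have returns (P : pred S) x : 0 < nstep p (\sum_(s | P s) (t s + t s)) x x.
  elim/big_ind: _ => [|i j pi pj|s _]; first by rewrite nstep0 eqxx.
    exact: nstep_pos_add pi pj.
  exact: back.
have /card_gt0P[s0 _] := S_gt0.
exists (\sum_s (t s + t s))%N.
  by rewrite (bigD1 s0)//= addn_gt0 addn_gt0 (tP s0).1.
move=> s; have [y0 xy0] := delta_surj coxW bld base (gen s).
have : 0 < nstep p (\sum_s (t s + t s)) base y0.
  by rewrite (bigD1 s)//= addnC; apply: nstep_pos_add (returns _ _) (cross _ _ _ xy0).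
by move=> /nstep_lower_bound[e e_gt0 eP]; exists e => // x y xy; rewrite eP// xy xy0.
Qed.

(** The walk at a common crossing time dominates a multiple of the adjacency
    kernel, which contracts, and the rest is doubly substochastic. *)
Lemma isotropic_spectral_radius (J : {set S}) (c : R) (h : Delta -> R) :
  (0 < #|J|)%N -> 0 <= c < 1 -> (forall x, 0 < h x) ->
  (forall x, (\esum_(y in [set: Delta]) (adjacency R gen delta q J x y * h y)%:E <=
     (c * h x)%:E)%E) ->
  forall x y, (spectral_radius p x y < 1)%E.
Proof.
move=> J_gt0 /andP[c_ge0 c_lt1] h_gt0 hP.
have n_gt0 : 0 < #|J|%:R :> R by rewrite ltr0n.
set Q := adjacency R gen delta q J in hP.
have Q_ge0 x y : 0 <= Q x y by apply: adjacency_ge0.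
have Q_sym x y : Q x y = Q y x by apply: (adjacency_sym R coxW q bld).
have colp y : (\esum_(x in [set: Delta]) (p x y)%:E <= 1)%E.
  rewrite (isotropic_column_sum coxW bld reg (transition_ge0 transp) isop y).
  by rewrite transp.2.
have [|N N_gt0 crossN] := common_crossing_time.
  by apply: leq_trans J_gt0 (max_card _).
have /choice[e eP] : forall s, exists e, 0 < e /\
    forall x y, delta x y = gen s -> e <= nstep p N x y.
  by move=> s; have [e e0 eP] := crossN s; exists e.
(* A common lower bound, at most 1/2, of the finitely many values of e. *)
pose d : R := (2 + \sum_s (e s)^-1)^-1.
have sum_ge0 : 0 <= \sum_s (e s)^-1.
  by apply: sumr_ge0 => s _; rewrite invr_ge0 ltW// (eP s).1.
have d_gt0 : 0 < d by rewrite invr_gt0; lra.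
have d_le1 : d <= 2^-1 by rewrite lef_pV2 ?posrE//; lra.
have d_le s : d <= e s.
  rewrite -[e s]invrK lef_pV2 ?posrE ?invr_gt0 ?(eP s).1//; last lra.
  rewrite (bigD1 s)//= addrCA lerDl addr_ge0// sumr_ge0// => r _.
  by rewrite invr_ge0 ltW// (eP r).1.
have dQ x y : d * Q x y <= nstep p N x y.
  have -> : nstep p N x y = #|J|%:R^-1 * \sum_(s in J) nstep p N x y.
    by rewrite sumr_const -(mulr_natl (nstep p N x y)) mulKf// gt_eqF.
  rewrite /Q /adjacency mulrCA ler_wpM2l ?invr_ge0 ?ler0n// mulr_sumr.
  apply: ler_sum => s _; have [xy|xy] := pselect (delta x y = gen s); last first.
    by rewrite sphere_notin// !mulr0 (nstep_ge0 transp).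
  rewrite sphere_in// mulr1; apply: le_trans ((eP s).2 _ _ xy).
  apply: le_trans (d_le s); rewrite ler_piMr ?(ltW d_gt0)//.
  by rewrite invf_le1 ?ler1n ?ltr0n; apply: ltnW.
have Q_row x : (\esum_(y in [set: Delta]) (Q x y)%:E = 1)%E.
  under eq_esum do rewrite -[Q _ _]mulr1.
  rewrite (adjacency_radial_sum coxW bld reg thickq J_gt0 x x (f := fun=> 1))//.
  by rewrite /drift big1 ?mulr0 ?addr0// => s _; rewrite subrr mulr0.
have rest (k : Delta -> Delta -> R) (Q' : Delta -> Delta -> R) x :
    (forall y, 0 <= Q' x y) -> (forall y, d * Q' x y <= k x y) ->
    (\esum_(y in [set: Delta]) (k x y)%:E <= 1)%E ->
    (\esum_(y in [set: Delta]) (Q' x y)%:E = 1)%E ->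
    (\esum_(y in [set: Delta]) ((k x y - d * Q' x y) * 1)%:E <= ((1 - d) * 1)%:E)%E.
  move=> Q'_ge0 dk k1 Q'1; rewrite mulr1 EFinB leeBrDr//.
  apply: le_trans k1; rewrite -[X in (_ + X <= _)%E]mule1 -Q'1 -esumZl ?(ltW d_gt0)//.
  rewrite -esumD; last 2 first.
  - by move=> y _; rewrite mulr1 lee_fin subr_ge0.
  - by move=> y _; rewrite -EFinM lee_fin mulr_ge0// ltW.
  by apply: le_esum => y _; rewrite mulr1 -EFinM -EFinD subrK.
apply: (spectral_radius_lt1 transp colp N_gt0 (c := d * c + (1 - d))); last first.
  apply/andP; split; first by rewrite addr_ge0 ?mulr_ge0 ?(ltW d_gt0)//; lra.
  have : d * c < d by rewrite gtr_pMr.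
  by lra.
apply: (form_boundD (k1 := fun x y => d * Q x y)
    (k2 := fun x y => nstep p N x y - d * Q x y)).
- by move=> x y; rewrite mulr_ge0// ltW.
- by move=> x y; rewrite subr_ge0.
- by move=> x y; rewrite addrC subrK.
- have row x : (\esum_(y in [set: Delta]) (d * Q x y * h y)%:E <= (d * c * h x)%:E)%E.
    under eq_esum do rewrite -mulrA EFinM.
    rewrite esumZl ?(ltW d_gt0)//; last by move=> y; rewrite lee_fin mulr_ge0// ltW.
    by rewrite -mulrA EFinM lee_wpmul2l ?lee_fin ?(ltW d_gt0).
  apply: (schur_test (h := h)) => // [x y|y]; first by rewrite mulr_ge0// ltW.
  by under eq_esum do rewrite Q_sym.
- apply: (schur_test (h := fun=> 1)) => // [x y|x|y]; first by rewrite subr_ge0.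
    by apply: rest => //; rewrite (nstep_row transp).
  under eq_esum do rewrite Q_sym.
  apply: (rest (fun y x => nstep p N x y)) => //; last exact: nstep_col.
  by move=> x; rewrite Q_sym.
- by rewrite mulr_ge0 ?(ltW d_gt0).
- lra.
Qed.

End Walks.

Theorem corollary4p9 (R : realType)
    (S : finType) (W : groupType) (gen : S -> W) (m : S -> S -> option nat)
    (Delta : choiceType) (delta : Delta -> Delta -> W) (q : S -> nat)
    (p : Delta -> Delta -> R) :
  is_coxeter_system gen m ->
  is_fuchsian m ->
  is_building gen delta ->
  is_regular gen delta q ->
  is_thick q ->
  is_transition_matrix p ->
  is_isotropic p delta ->
  has_bounded_range p gen delta ->
  is_irreducible p ->
  forall x y : Delta, (spectral_radius p x y < 1)%E.
Proof.
move=> coxW fuchs bld reg thickq transp isop _ irrp.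
have [J [phi [C [J_gt0 C_ge1 phiP]]]] := fuchsian_potential R coxW thickq fuchs.
have [c c01 [h h_gt0 hP]] :=
  adjacency_contraction coxW bld reg thickq J_gt0 C_ge1 phiP.
exact: (isotropic_spectral_radius coxW bld reg thickq transp isop irrp
  J_gt0 c01 h_gt0 hP).
Qed.
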